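(* Fix an integer $k\ge 1$. There is an algorithm that, given a graph $G$ with $n$ vertices and $m$ edges, decides in time $O(n^{k+4}(n+m))$ whether $G$ is a proper $k$-color-line graph; moreover, if $G$ is a proper $k$-color-line graph, the algorithm outputs within the same time bound a graph $H$ together with a proper edge $k$-coloring of $H$ such that $G\cong\mathrm{CL}(H)$.
   Context: An edge $k$-coloring of a graph $H$ is a map $\phi:E(H)\to\{1,\dots,k\}$; it is proper if any two distinct edges sharing an endvertex get different colors. For an edge-colored graph $(H,\phi)$, the color-line graph $\mathrm{CL}(H)$ has vertex set $E(H)$, two distinct vertices being adjacent iff the corresponding edges of $H$ share an endvertex or have the same color. $G$ is a proper $k$-color-line graph if $G\cong\mathrm{CL}(H)$ for some graph $H$ with a proper edge $k$-coloring. *)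

(* Defs.v *)
From mathcomp Require Import all_boot.

Set Implicit Arguments.
Unset Strict Implicit.
Unset Printing Implicit Defensive.

(** * Finite simple graphs and color-line graphs *)

Record sgraph := SGraph {
  vert :> finType;
  adj : rel vert;
  adj_sym : symmetric adj;
  adj_irr : irreflexive adj }.

Definition edge_set (G : sgraph) : {set {set G}} :=
  [set [set x; y] | x in G, y in G & adj x y].

Definition edge (G : sgraph) : finType := {e : {set G} | e \in edge_set G}.

Definition share_end (H : sgraph) (e f : edge H) : bool :=
  val e :&: val f != set0.

(* ['I_k] stands for the color set {1, ..., k}. *)
Definition proper_coloring (k : nat) (H : sgraph) (phi : edge H -> 'I_k) : Prop :=
  forall e f : edge H, e != f -> share_end e f -> phi e != phi f.

Section ColorLine.
Variables (k : nat) (H : sgraph) (phi : edge H -> 'I_k).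

Definition cl_adj : rel (edge H) :=
  fun e f => (e != f) && (share_end e f || (phi e == phi f)).

Lemma cl_adj_sym : symmetric cl_adj.
Proof.
by move=> e f; rewrite /cl_adj /share_end eq_sym setIC [phi e == _]eq_sym.
Qed.

Lemma cl_adj_irr : irreflexive cl_adj.
Proof. by move=> e; rewrite /cl_adj eqxx. Qed.

Definition CL : sgraph := SGraph cl_adj_sym cl_adj_irr.
End ColorLine.

Definition graph_iso (G G' : sgraph) : Prop :=
  exists2 f : G -> G', bijective f & forall x y, adj (f x) (f y) = adj x y.

Definition proper_color_line_graph (k : nat) (G : sgraph) : Prop :=
  exists (H : sgraph) (phi : edge H -> 'I_k),
    proper_coloring phi /\ graph_iso G (CL phi).

(** * Word RAM

    Programs are structured imperative programs over registers and arrays of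
    natural numbers. Register and array names are fixed in the program text,
    so a program uses finitely many of each; array indices are computed. Every
    arithmetic operation, comparison, register or array access, assignment and
    test has cost 1. All numbers that occur must be smaller than the word bound
    [W]: a program that exceeds it has no execution. Taking [W] polynomial in
    the input size gives the usual model with words of O(log n) bits. *)

Inductive binop := Add | Sub | Mul | Div | Eq | Lt.

Inductive expr :=
  | Lit of nat
  | Reg of nat
  | Read of nat & expr
  | Bin of binop & expr & expr.

Inductive cmd :=
  | Skip
  | Assign of nat & expr
  | Write of nat & expr & expr
  | Seq of cmd & cmd
  | If of expr & cmd & cmd
  | While of expr & cmd.

Record state := State { reg : nat -> nat; arr : nat -> nat -> nat }.

Definition set_reg (s : state) (r v : nat) : state :=
  State (fun r' => if r' == r then v else reg s r') (arr s).

Definition set_arr (s : state) (a i v : nat) : state :=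
  State (reg s)
    (fun a' i' => if (a' == a) && (i' == i) then v else arr s a' i').

(* Subtraction is truncated and [x / 0 = 0]; comparisons return 0 or 1. *)
Definition eval_op (o : binop) (x y : nat) : nat :=
  match o with
  | Add => x + y
  | Sub => x - y
  | Mul => x * y
  | Div => x %/ y
  | Eq => x == y
  | Lt => x < y
  end.

Fixpoint eval (s : state) (e : expr) : nat :=
  match e with
  | Lit v => v
  | Reg r => reg s r
  | Read a i => arr s a (eval s i)
  | Bin o e1 e2 => eval_op o (eval s e1) (eval s e2)
  end.

Fixpoint fits (W : nat) (s : state) (e : expr) : bool :=
  (eval s e < W) &&
  match e with
  | Lit _ | Reg _ => true
  | Read _ i => fits W s i
  | Bin _ e1 e2 => fits W s e1 && fits W s e2
  end.

Fixpoint cost (e : expr) : nat :=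
  match e with
  | Lit _ | Reg _ => 1
  | Read _ i => (cost i).+1
  | Bin _ e1 e2 => (cost e1 + cost e2).+1
  end.

(* [exec W p s s' t]: with word bound [W], the program [p] started in [s]
   halts in [s'] after [t] steps. *)
Inductive exec (W : nat) : cmd -> state -> state -> nat -> Prop :=
  | ExecSkip s : exec W Skip s s 1
  | ExecAssign s r e :
      fits W s e ->
      exec W (Assign r e) s (set_reg s r (eval s e)) (cost e).+1
  | ExecWrite s a i e :
      fits W s i -> fits W s e ->
      exec W (Write a i e) s (set_arr s a (eval s i) (eval s e))
        (cost i + cost e).+1
  | ExecSeq s1 s2 s3 c1 c2 t1 t2 :
      exec W c1 s1 s2 t1 -> exec W c2 s2 s3 t2 ->
      exec W (Seq c1 c2) s1 s3 (t1 + t2)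
  | ExecIf s s' b c1 c2 t :
      fits W s b -> exec W (if eval s b != 0 then c1 else c2) s s' t ->
      exec W (If b c1 c2) s s' (cost b + t).+1
  | ExecWhileStop s b c :
      fits W s b -> eval s b = 0 ->
      exec W (While b c) s s (cost b).+1
  | ExecWhileStep s1 s2 s3 b c t1 t2 :
      fits W s1 b -> eval s1 b != 0 ->
      exec W c s1 s2 t1 -> exec W (While b c) s2 s3 t2 ->
      exec W (While b c) s1 s3 (cost b + t1 + t2).+1.

(** * Input and output conventions *)

(* [es] lists every edge of [G] exactly once, in any order and orientation. *)
Definition edge_list (G : sgraph) (es : seq (G * G)) : Prop :=
  perm_eq [seq [set p.1; p.2] | p <- es] (enum (edge_set G)).

Definition tails (G : sgraph) (es : seq (G * G)) : seq nat :=
  [seq nat_of_ord (enum_rank p.1) | p <- es].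

Definition heads (G : sgraph) (es : seq (G * G)) : seq nat :=
  [seq nat_of_ord (enum_rank p.2) | p <- es].

(* Vertices are numbered 0, ..., n - 1. Registers 0 and 1 hold the numbers of
   vertices and edges, arrays 0 and 1 the two ends of the listed edges; all
   other memory is zero. *)
Definition input_state (G : sgraph) (es : seq (G * G)) : state :=
  State (nth 0 [:: #|G|; size es])
        (fun a => nth 0 (nth [::] [:: tails es; heads es] a)).

Definition accepts (s : state) : Prop := reg s 2 != 0.

(* Registers 3 and 4 hold the numbers of vertices and edges of [H]; arrays 2
   and 3 the two ends and array 4 the color of each edge. *)
Definition outputs (s : state) (k : nat) (H : sgraph) (phi : edge H -> 'I_k)
    : Prop :=
  exists es : seq (H * H),
    [/\ edge_list es,
        reg s 3 = #|H| /\ reg s 4 = size es,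
        mkseq (arr s 2) (size es) = tails es /\
        mkseq (arr s 3) (size es) = heads es
      & forall (e : edge H) (i : nat) (p : H * H),
          onth es i = Some p -> val e = [set p.1; p.2] ->
          arr s 4 i = phi e].

(* Main.v *)
Require Import Defs.
From mathcomp Require Import all_boot zify.

(** In a proper [k]-color-line graph [G] the color classes are [k] cliques, and
    removing the edges inside them leaves the line graph [L] of [H]. A vertex
    has at most two neighbors in a class other than its own (one per end of the
    edge it stands for), so three vertices of a class determine it: the class
    contains every vertex adjacent to all three. Hence a string of [3 k]
    guessed colors, each given to some uncolored vertex and followed by
    absorbing the vertices with three neighbors of that color, produces the
    whole partition, and the number of such strings does not depend on [G].

    Let [x v u] say at which end of the edge [v] it meets the edge [u]. Such a
    family comes from a root graph iff, for neighbors [u <> w] of [v] in [L],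
    [x v u = x v w] holds exactly when [u] and [w] are adjacent in [L] and
    [x u v = x u w]. The values at [v] determine those at its neighbors up to
    exchanging ends, so a component of [L] is solved by trying the values at
    one vertex and propagating; two neighbors of a vertex with the same color
    lie at different ends, so a subset of the colors encodes these values.
    The ends [(v, t)], identified along [L], are the vertices of [H]. *)

Set Implicit Arguments.
Unset Strict Implicit.
Unset Printing Implicit Defensive.

(** * Graph isomorphisms *)

Lemma graph_iso_sym (G1 G2 : sgraph) : graph_iso G1 G2 -> graph_iso G2 G1.
Proof.
case=> f [g fK gK] f_adj; exists g; first by exists f.
by move=> x y; rewrite -f_adj !gK.
Qed.

Lemma graph_iso_trans (G1 G2 G3 : sgraph) :
  graph_iso G1 G2 -> graph_iso G2 G3 -> graph_iso G1 G3.
Proof.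
case=> f f_bij f_adj [g g_bij g_adj]; exists (g \o f); first exact: bij_comp.
by move=> x y; rewrite /= g_adj f_adj.
Qed.

Section OrdinalGraph.
Variable G : sgraph.

Definition ord_adj : rel 'I_#|G| := fun i j => adj (enum_val i) (enum_val j).

Lemma ord_adj_sym : symmetric ord_adj.
Proof. by move=> i j; apply: adj_sym. Qed.

Lemma ord_adj_irr : irreflexive ord_adj.
Proof. by move=> i; apply: adj_irr. Qed.

Definition ord_graph : sgraph := SGraph ord_adj_sym ord_adj_irr.

Lemma ord_graph_iso : graph_iso G ord_graph.
Proof.
exists enum_rank; first exact: enum_rank_bij.
by move=> x y; rewrite /= /ord_adj !enum_rankK.
Qed.

End OrdinalGraph.

(** * End systems *)

Section EndSystem.
Variables (V : finType) (link : rel V).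
Hypothesis link_sym : symmetric link.
Implicit Types (x y : V -> V -> bool) (v u w : V).

(* Read [x v u] as the end of the edge [v] at which it meets the edge [u]. *)
Definition consistent_at x v : Prop :=
  forall u w, u != w -> link v u -> link v w ->
    (x v u == x v w) = link u w && (x u v == x u w).

Definition consistent x : Prop := forall v, consistent_at x v.

Definition agree_at x y v : Prop :=
  exists b, forall u, link v u -> y v u = x v u (+) b.

Lemma agree_at_neighbor x y v w :
  consistent x -> link v w -> agree_at x y w ->
  (forall u, y v u = ~~ ((u == w) || link w u && (y w u == y w v))) ->
  agree_at x y v.
Proof.
move=> cx vw [b yw] yv; exists (x v w) => u vu; rewrite yv.
have [->|uw] /= := eqVneq u w; first by rewrite addbb.
have wv : link w v by rewrite link_sym.
case: (boolP (link w u)) => wu /=; last first.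
  have := cx v u w uw vu vw; rewrite link_sym (negbTE wu) /=.
  by case: (x v u); case: (x v w).
have := cx v w u; rewrite eq_sym => /(_ uw vw vu); rewrite !yw // wu.
by case: (x v u); case: (x v w); case: (x w u); case: (x w v); case: (b).
Qed.

Lemma consistent_at_agree x y v :
  consistent x -> agree_at x y v -> (forall u, link v u -> agree_at x y u) ->
  consistent_at y v.
Proof.
move=> cx [b yv] yu u w uw vu vw; have [b' yu'] := yu u vu.
have uv : link u v by rewrite link_sym.
rewrite !yv // yu' //; have := cx v u w uw vu vw.
case: (boolP (link u w)) => [/yu'->|_] /=.
  by case: (x v u); case: (x v w); case: (x u v); case: (x u w);
    case: (b); case: (b').
by case: (x v u); case: (x v w); case: (b).
Qed.

Lemma eq_consistent_at x y v :
  y v =1 x v -> (forall u, link v u -> y u =1 x u) ->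
  consistent_at x v -> consistent_at y v.
Proof. by move=> yv yu cx u w uw vu vw; rewrite !yv !(yu u vu) cx. Qed.

Lemma consistent_merge (K D : {set V}) x y :
  closed link K -> closed link D ->
  {in D, forall v, consistent_at x v} -> {in K, forall v, consistent_at y v} ->
  {in K :|: D,
    forall v, consistent_at (fun v u => if v \in K then y v u else x v u) v}.
Proof.
move=> closed_K closed_D cx cy v; rewrite inE; case: (boolP (v \in K)) => vK /=.
  by move=> _; apply: eq_consistent_at (cy v vK) => [|u vu] w;
    rewrite -?(closed_K v u) ?vK.
by move=> /cx; apply: eq_consistent_at => [|u vu] w;
  rewrite -?(closed_K v u) ?(negbTE vK).
Qed.

Definition same_end x (p q : V * bool) : bool :=
  (p == q) ||
  [&& link p.1 q.1, x p.1 q.1 == p.2 & x q.1 p.1 == q.2].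

Lemma same_end_refl x : reflexive (same_end x).
Proof. by move=> p; rewrite /same_end eqxx. Qed.

Lemma same_end_sym x : symmetric (same_end x).
Proof. by move=> p q; rewrite /same_end eq_sym link_sym [X in _ && X]andbC. Qed.

Lemma same_end_trans x : consistent x -> transitive (same_end x).
Proof.
move=> cx [v a] [u b] [w c] /predU1P[-> //|/and3P[/= uv /eqP <- /eqP xvu]].
case/predU1P=> [<-|/and3P[/= vw /eqP xvw /eqP <-]].
  by rewrite /same_end /= uv xvu !eqxx orbT.
have vu : link v u by rewrite link_sym.
have wv : link w v by rewrite link_sym.
have [->|uw] := eqVneq u w; first by rewrite same_end_refl.
have := cx v u w uw vu vw; rewrite xvu xvw eqxx => /esym/andP[link_uw /eqP xuv].
have := cx v w u; rewrite eq_sym xvu xvw eqxx => /(_ uw vw vu) /esym/andP[_ /eqP xwv].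
by rewrite /same_end /= link_uw xuv xwv !eqxx orbT.
Qed.

End EndSystem.

(** * Certificates *)

Section Certificate.
Variable V : finType.
Implicit Types (A : rel V) (col : {ffun V -> nat}) (x : V -> V -> bool).

Definition link A col : rel V := fun u v => A u v && (col u != col v).

Lemma link_sym A col : symmetric A -> symmetric (link A col).
Proof. by move=> symA u v; rewrite /link symA eq_sym. Qed.

Record certificate A (k : nat) col x : Prop := Certificate {
  color_lt : forall v, col v < k;
  color_clique : forall u v, u != v -> col u = col v -> A u v;
  ends_consistent : consistent (link A col) x }.

(* Two neighbors of [v] in one class are not linked, hence meet [v] at
   different ends. *)
Lemma color_of_three_neighbors A k col x v c : certificate A k col x ->
  2 < #|[set u | A v u & col u == c]| -> col v = c.
Proof.
move=> cert /card_gt2P[u1 [u2 [u3 [[]]]]].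
rewrite !inE => /andP[adj1 /eqP col1] /andP[adj2 /eqP col2].
move=> /andP[adj3 /eqP col3] [u12 u23 u31].
apply/eqP; case: eqP => // /eqP vc.
have vu u : A v u -> col u = c -> link A col v u by move=> Au cu; rewrite /link Au cu.
have apart u w : u != w -> A v u -> A v w -> col u = c -> col w = c ->
    (x v u == x v w) = false.
  move=> uw Au Aw cu cw; rewrite (ends_consistent cert) ?vu //.
  by rewrite /link cu cw eqxx andbF.
have := apart _ _ u12 adj1 adj2 col1 col2.
have := apart _ _ u23 adj2 adj3 col2 col3.
have := apart _ _ u31 adj3 adj1 col3 col1.
by case: (x v u1); case: (x v u2); case: (x v u3).
Qed.

End Certificate.

(** ** From a root graph to a certificate *)

Lemma eq_set2 (T : finType) (a b c d : T) :
  [set a; b] = [set c; d] -> (a = c /\ b = d) \/ (a = d /\ b = c).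
Proof.
move=> same; have /set2P a_cd : a \in [set c; d] by rewrite -same set21.
have /set2P b_cd : b \in [set c; d] by rewrite -same set22.
have /set2P c_ab : c \in [set a; b] by rewrite same set21.
have /set2P d_ab : d \in [set a; b] by rewrite same set22.
by intuition congruence.
Qed.

Lemma mem_edge_set (G : sgraph) (x y : G) : ([set x; y] \in edge_set G) = adj x y.
Proof.
apply/imset2P/idP => [[a b _]|xy]; last by exists x y; rewrite ?inE.
by rewrite !inE => ab /eq_set2[] [-> ->] //; rewrite adj_sym.
Qed.

Section RootToCertificate.
Variable H : sgraph.
Implicit Types e f g : edge H.

Lemma card_edge e : #|val e| = 2.
Proof.
have /imset2P[a b _] := valP e; rewrite !inE => ab ->; rewrite cards2.
by case: eqP ab => // ->; rewrite adj_irr.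
Qed.

Lemma edges_meet_once e f a b :
  e != f -> a \in val e -> a \in val f -> b \in val e -> b \in val f -> a = b.
Proof.
move=> ef ae af be bf; apply/eqP; case: eqVneq => // ab; case/eqP: ef.
have ab_eq g : a \in val g -> b \in val g -> [set a; b] = val g.
  move=> ag bg; apply/eqP; rewrite eqEcard subUset !sub1set ag bg.
  by rewrite card_edge cards2 ab.
by apply: val_inj; rewrite /= -(ab_eq e) // -(ab_eq f).
Qed.

Lemma eq_ends_of_edge e a b c :
  a \in val e -> b \in val e -> c \in val e -> ((a == b) == (a == c)) = (b == c).
Proof.
have /eqP/cards2P[p [q [/negbTE pq ->]]] := card_edge e.
have qp : (q == p) = false by rewrite eq_sym.
by rewrite !inE => /orP[]/eqP-> /orP[]/eqP-> /orP[]/eqP->; rewrite ?eqxx ?pq ?qp.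
Qed.

Lemma edge_nonempty e : exists a, a \in val e.
Proof. by apply/set0Pn; rewrite -card_gt0 card_edge. Qed.

Definition base_end e : H := xchoose (edge_nonempty e).

Definition line_adj : rel (edge H) := fun e f => (e != f) && share_end e f.

Lemma line_adjP e f :
  reflect (e != f /\ exists2 a, a \in val e & a \in val f) (line_adj e f).
Proof.
apply: (iffP andP) => [[ef /set0Pn[a]]|[ef [a ae af]]].
  by rewrite inE => /andP[ae af]; split=> //; exists a.
by split=> //; apply/set0Pn; exists a; rewrite inE ae.
Qed.

Definition meets_at_base e f : bool := base_end e \in val f.

Lemma meets_at_baseE e f a :
  e != f -> a \in val e -> a \in val f -> meets_at_base e f = (base_end e == a).
Proof.
move=> ef ae af; apply/idP/eqP => [base_f|base_a];
  last by rewrite /meets_at_base base_a.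
exact: edges_meet_once ef (xchooseP (edge_nonempty e)) base_f ae af.
Qed.

Lemma eq_meets_at_base e f g a b : e != f -> e != g ->
  a \in val e -> a \in val f -> b \in val e -> b \in val g ->
  (meets_at_base e f == meets_at_base e g) = (a == b).
Proof.
move=> ef eg ae af be bg.
rewrite (meets_at_baseE ef ae af) (meets_at_baseE eg be bg).
exact: eq_ends_of_edge (xchooseP (edge_nonempty e)) ae be.
Qed.

Lemma meets_at_base_consistent : consistent line_adj meets_at_base.
Proof.
move=> e f g fg /line_adjP[ef [a ae af]] /line_adjP[eg [b be bg]].
have fe : f != e by rewrite eq_sym.
rewrite (eq_meets_at_base ef eg ae af be bg).
apply/eqP/andP => [ab|[/line_adjP[_ [c cf cg]]]].
  rewrite -ab in bg; split; first by apply/line_adjP; split=> //; exists a.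
  by rewrite (eq_meets_at_base fe fg af ae af bg).
rewrite (eq_meets_at_base fe fg af ae cf cg) => /eqP ac.
by rewrite -ac in cg; apply: edges_meet_once eg ae cg be bg.
Qed.

End RootToCertificate.

Lemma certificate_of_coloring (k : nat) (G : sgraph) :
  proper_color_line_graph k G -> exists col x, certificate (@adj G) k col x.
Proof.
case=> H [phi [proper [f f_bij f_adj]]].
have f_inj : injective f := bij_inj f_bij.
pose col := [ffun v => val (phi (f v))]; pose x v u := meets_at_base (f v) (f u).
have linkE u v : link (@adj G) col u v = line_adj (f u) (f v).
  rewrite /link /line_adj -f_adj /= /cl_adj !ffunE (inj_eq val_inj).
  have [->|uv] //= := eqVneq (f u) (f v).
  case: (boolP (share_end _ _)) => [/(proper _ _ uv)->//|_] /=.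
  by case: (phi _ == _).
exists col, x; split=> [v|u v uv|v u w uw]; first by rewrite ffunE ltn_ord.
  rewrite !ffunE => /val_inj same_col.
  by rewrite -f_adj /= /cl_adj (inj_eq f_inj) uv same_col eqxx orbT.
rewrite !linkE => vu vw; apply: meets_at_base_consistent vu vw.
by rewrite (inj_eq f_inj).
Qed.

(** ** From a certificate to a root graph *)

Section CertificateToRoot.
Variables (G : sgraph) (k : nat) (col : {ffun G -> nat}) (x : G -> G -> bool).
Hypothesis cert : certificate (@adj G) k col x.

Local Notation linkG := (link (@adj G) col).

Variables (W : finType) (point : G * bool -> W).
Hypothesis eq_point : forall p q, (point p == point q) = same_end linkG x p q.

Lemma link_irr v : linkG v v = false.
Proof. by rewrite /link eqxx andbF. Qed.

Lemma point_false_neq_true v : point (v, false) != point (v, true).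
Proof. by rewrite eq_point /same_end -pair_eqE /= eqxx link_irr. Qed.

Definition root_adj : rel W := fun a b =>
  [exists v, exists t, (a == point (v, t)) && (b == point (v, ~~ t))].

Lemma root_adj_sym : symmetric root_adj.
Proof.
move=> a b; apply: eq_existsb => v.
by apply/existsP/existsP => -[t h]; exists (~~ t); rewrite negbK andbC.
Qed.

Lemma root_adj_irr : irreflexive root_adj.
Proof.
move=> a; apply/existsP => -[v /existsP[[] /andP[/eqP->]]]; last first.
  by rewrite (negbTE (point_false_neq_true v)).
by rewrite eq_sym (negbTE (point_false_neq_true v)).
Qed.

Definition root_graph : sgraph := SGraph root_adj_sym root_adj_irr.

Definition root_ends (v : G) : {set root_graph} :=
  [set point (v, false); point (v, true)].

Lemma root_endsP (e : {set root_graph}) :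
  reflect (exists v, e = root_ends v) (e \in edge_set root_graph).
Proof.
apply: (iffP imset2P) => [[a b _]|[v ->]].
  rewrite !inE => /existsP[v /existsP[t /andP[/eqP-> /eqP->]]] ->; exists v.
  by case: t; rewrite // setUC.
exists (point (v, false)) (point (v, true)); rewrite ?inE //.
by apply/existsP; exists v; apply/existsP; exists false; rewrite !eqxx.
Qed.

Lemma mem_root_ends v t : point (v, t) \in root_ends v.
Proof. by case: t; rewrite !inE eqxx ?orbT. Qed.

Lemma root_ends_inj : injective root_ends.
Proof.
move=> u v /eq_set2 ends; apply/eqP; case: eqVneq => // uv.
by case: ends => -[/eqP + /eqP];
  rewrite !eq_point /same_end -!pair_eqE /= (negbTE uv) /=;
  case: (x u v); rewrite ?andbF.
Qed.

Definition root_edge (v : G) : edge root_graph :=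
  exist _ (root_ends v) (introT (root_endsP _) (ex_intro _ v erefl)).

Lemma root_edge_surjective (e : edge root_graph) : exists v, root_edge v == e.
Proof. by have /root_endsP[v e_ends] := valP e; exists v; apply/eqP/val_inj. Qed.

Definition edge_vertex (e : edge root_graph) : G := xchoose (root_edge_surjective e).

Lemma edge_vertexK : cancel edge_vertex root_edge.
Proof. by move=> e; apply/eqP; apply: xchooseP (root_edge_surjective e). Qed.

Lemma root_edge_inj : injective root_edge.
Proof. by move=> u v /(congr1 val)/root_ends_inj. Qed.

Lemma root_edgeK : cancel root_edge edge_vertex.
Proof. by move=> v; apply: root_edge_inj; rewrite edge_vertexK. Qed.

Definition root_color (e : edge root_graph) : 'I_k :=
  Ordinal (color_lt cert (edge_vertex e)).

Lemma share_end_root_edge u v :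
  u != v -> share_end (root_edge u) (root_edge v) = linkG u v.
Proof.
move=> uv; apply/set0Pn/idP => [[a]|link_uv].
  rewrite !inE => /andP[/orP[]/eqP-> /orP[]];
    by rewrite eq_point /same_end -pair_eqE /= (negbTE uv) => /and3P[].
exists (point (u, x u v)); rewrite inE mem_root_ends /=.
rewrite (eqP (_ : point (u, x u v) == point (v, x v u))) ?mem_root_ends //.
by rewrite eq_point /same_end /= link_uv !eqxx orbT.
Qed.

Lemma root_color_proper : proper_coloring root_color.
Proof.
move=> e f; rewrite -(edge_vertexK e) -(edge_vertexK f).
move: (edge_vertex e) (edge_vertex f) => u v; rewrite (inj_eq root_edge_inj) => uv.
by rewrite share_end_root_edge // -val_eqE /= !root_edgeK => /andP[].
Qed.

Lemma root_graph_iso : graph_iso G (CL root_color).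
Proof.
exists root_edge.
  by exists edge_vertex; [exact: root_edgeK | exact: edge_vertexK].
move=> u v; rewrite /= /cl_adj (inj_eq root_edge_inj).
have [->|uv] /= := eqVneq u v; first by rewrite adj_irr.
rewrite share_end_root_edge // -val_eqE /= !root_edgeK /link.
case: eqP => [same_col|_]; last by rewrite andbT orbF.
by rewrite orbT (color_clique cert).
Qed.

Definition root_pairs : seq (root_graph * root_graph) :=
  [seq (point (v, false), point (v, true)) | v <- enum G].

Lemma root_pairs_edge_list : edge_list root_pairs.
Proof.
rewrite /edge_list -map_comp; apply: uniq_perm.
- by rewrite (map_inj_uniq root_ends_inj) enum_uniq.
- exact: enum_uniq.
- move=> e; rewrite mem_enum; apply/mapP/root_endsP => [[v _ ->]|[v ->]];
    exists v => //.
  by rewrite mem_enum.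
Qed.

End CertificateToRoot.

(** * Guessing the color classes *)

Section Guess.
Variables (n k : nat) (A : rel 'I_n).
Implicit Types (col : {ffun 'I_n -> nat}) (c d : nat) (u v : 'I_n).

(* Vertices of color [k] are uncolored. *)
Definition color_last col c : {ffun 'I_n -> nat} :=
  [ffun u => if (col u == k) && (\max_(v | col v == k) val v == u)
             then c else col u].

Definition crowded col c u : bool := 2 < #|[set v | A u v & col v == c]|.

Definition absorb col c : {ffun 'I_n -> nat} :=
  [ffun u => if (col u == k) && crowded col c u then c else col u].

Definition color_next col c : {ffun 'I_n -> nat} := absorb (color_last col c) c.

Definition color_all (g : seq nat) : {ffun 'I_n -> nat} :=
  foldl color_next [ffun=> k] g.

Definition color_class col c : {set 'I_n} := [set v | col v == c].

Lemma color_class_next col c d :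
  d != c -> d < k -> color_class (color_next col c) d = color_class col d.
Proof.
rewrite eq_sym => /negbTE cd dk; have kd : (k == d) = false by rewrite gtn_eqF.
apply/setP => u; rewrite !inE !ffunE.
have [->|/negbTE uk] /= := eqVneq (col u) k; last by rewrite uk.
by rewrite kd; do 2!case: ifP; rewrite ?cd ?kd.
Qed.

Lemma color_next_full col c : (forall v, col v != k) -> color_next col c = col.
Proof.
move=> full; apply/ffunP => u.
by rewrite !ffunE (negbTE (full u)) /= (negbTE (full u)).
Qed.

Section Completeness.
Variable q : {ffun 'I_n -> nat}.
Hypothesis q_lt : forall v, q v < k.
Hypothesis q_clique : forall u v, u != v -> q u = q v -> A u v.
Hypothesis q_crowded : forall v c, crowded q c v -> q v = c.

Definition partial col : Prop := forall v, col v = k \/ col v = q v.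

Definition saturated col c : Prop :=
  #|color_class col c| <= 2 \/ forall v, q v = c -> col v = c.

Definition promising col : Prop := partial col /\ forall c, c < k -> saturated col c.

Lemma partial_color col c v : c < k -> partial col -> col v = c -> q v = c.
Proof. by move=> ck part; case: (part v) => -> // kc; rewrite kc ltnn in ck. Qed.

Lemma partial_color_last col u :
  partial col -> \max_(v | col v == k) val v = u -> partial (color_last col (q u)).
Proof.
move=> part last_u v; rewrite ffunE last_u.
by case: ifP => [/andP[_ /eqP/val_inj->]|_]; [right | apply: part].
Qed.

Lemma partial_absorb col c : c < k -> partial col -> partial (absorb col c).
Proof.
move=> ck part u; rewrite ffunE; case: ifP => [/andP[_ crowd]|_]; last exact: part.
right; apply/esym/q_crowded; apply: leq_trans crowd _.
apply/subset_leq_card/subsetP => v; rewrite !inE => /andP[-> /eqP].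
by move/(partial_color ck part)->; rewrite eqxx.
Qed.

Lemma saturated_absorb col c : c < k -> partial col -> saturated (absorb col c) c.
Proof.
move=> ck part; have kc : (k == c) = false by rewrite gtn_eqF.
have [few|many] := leqP #|color_class col c| 2; [left | right=> u qu].
  apply: (leq_trans _ few); apply/subset_leq_card/subsetP => u; rewrite !inE ffunE.
  case: ifP => // /andP[_ crowd] _; apply: contraTT crowd => _; rewrite -leqNgt.
  by apply: leq_trans few; apply/subset_leq_card/subsetP => v;
    rewrite !inE => /andP[].
rewrite ffunE; case: (part u) => [uk|->]; last by rewrite qu ltn_eqF.
rewrite uk eqxx /= ifT //; apply: leq_trans many _.
apply/subset_leq_card/subsetP => v; rewrite !inE => /eqP vc; rewrite vc eqxx andbT.
apply: q_clique; last by rewrite qu (partial_color ck part vc).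
by apply: contraFneq kc => uv; rewrite -uk uv vc.
Qed.

Lemma promising_next col u : promising col -> \max_(v | col v == k) val v = u ->
  promising (color_next col (q u)).
Proof.
move=> [part sat] last_u; have part_u := partial_color_last part last_u.
split=> [|d dk]; first exact: partial_absorb.
have [->|dc] := eqVneq d (q u); first exact: saturated_absorb.
case: (sat d dk) => [few|all_d]; [left | right=> v /all_d vd].
  by rewrite color_class_next.
have : v \in color_class col d by rewrite inE vd.
by rewrite -(color_class_next col dc) // inE => /eqP.
Qed.

(* Every guess puts a vertex into a class with at most two vertices so far. *)
Definition progress col : nat := \sum_(c < k) minn 3 #|color_class col c|.

Lemma class_grows col u : promising col -> col u = k ->
  \max_(v | col v == k) val v = u ->
  #|color_class col (q u)| <= 2 /\
  #|color_class col (q u)| < #|color_class (color_next col (q u)) (q u)|.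
Proof.
move=> [part sat] uk last_u; have ku : (k == q u) = false by rewrite gtn_eqF.
split.
  by case: (sat _ (q_lt u)) => // /(_ u erefl) uq; rewrite -uq uk eqxx in ku.
apply/proper_card/properP; split; last first.
  by exists u; rewrite !inE ?uk ?ku // !ffunE uk last_u !eqxx if_same eqxx.
by apply/subsetP => v; rewrite !inE !ffunE => /eqP->; rewrite !if_same.
Qed.

Lemma progress_next col u : promising col -> col u = k ->
  \max_(v | col v == k) val v = u -> progress col < progress (color_next col (q u)).
Proof.
move=> prom uk last_u; have [few grows] := class_grows prom uk last_u.
rewrite /progress (bigD1 (Ordinal (q_lt u))) //=.
rewrite [X in _ < X](bigD1 (Ordinal (q_lt u))) //= -addSn leq_add //.
  by rewrite (minn_idPr (leqW few)) leq_min ltnS few.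
by apply: leq_sum => d dc; rewrite color_class_next.
Qed.

Lemma promising_complete col : promising col -> 3 * k <= progress col -> col = q.
Proof.
move=> [part sat] prog; apply/ffunP => v; case: (part v) => // vk.
case: (sat _ (q_lt v)) => [few|]; last exact.
suff : progress col < 3 * k by rewrite ltnNge prog.
rewrite /progress (bigD1 (Ordinal (q_lt v))) //=.
apply: (@leq_ltn_trans (2 + \sum_(i < k | i != Ordinal (q_lt v)) 3)).
  rewrite leq_add ?(leq_trans (geq_minr _ _)) // leq_sum // => i _.
  exact: geq_minl.
by rewrite sum_nat_const cardC1 card_ord; have := q_lt v; lia.
Qed.

Lemma exists_promising_guess d : 0 < k -> exists g : d.-tuple 'I_k,
  let col := color_all [seq val i | i <- g] in
  promising col /\ ((forall v, col v != k) \/ d <= progress col).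
Proof.
move=> k_gt0; elim: d => [|d [g [prom enough]]].
  exists [tuple]; split; last by right.
  split=> [v|c ck]; [by left; rewrite ffunE | left].
  by rewrite (_ : color_class _ _ = set0) ?cards0 //; apply/setP => v;
    rewrite !inE ffunE gtn_eqF.
set col := color_all _ in prom enough.
have next (i : 'I_k) :
    color_all [seq val j | j <- rcons g i] = color_next col (val i).
  by rewrite map_rcons /color_all foldl_rcons.
have [full|] := boolP [forall v, col v != k].
  exists (rcons_tuple g (Ordinal k_gt0)); rewrite /= next color_next_full.
    by split=> //; left; apply/forallP.
  exact/forallP.
rewrite negb_forall => /existsP[v]; rewrite negbK => vk.
have [|u] := @eq_bigmax_cond _ [pred v | col v == k] val.
  by apply/card_gt0P; exists v.
rewrite inE => /eqP uk last_u.
exists (rcons_tuple g (Ordinal (q_lt u))); rewrite /= next; split;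
  first exact: promising_next.
right; case: enough => [/(_ v)|enough]; first by rewrite (eqP vk) eqxx.
exact: leq_ltn_trans enough (progress_next prom uk last_u).
Qed.

Lemma exists_guess : 0 < k ->
  exists g : (3 * k).-tuple 'I_k, color_all [seq val i | i <- g] = q.
Proof.
move=> k_gt0; have [g [prom [full|enough]]] := exists_promising_guess (3 * k) k_gt0;
  exists g.
  by apply/ffunP => v; case: (prom.1 v) (full v) => -> //; rewrite eqxx.
exact: promising_complete.
Qed.

End Completeness.

Lemma guess_of_certificate col x : 0 < k -> certificate A k col x ->
  exists g : (3 * k).-tuple 'I_k, color_all [seq val i | i <- g] = col.
Proof.
move=> k_gt0 cert; apply: exists_guess => //.
- exact: color_lt cert.
- exact: color_clique cert.
- by move=> v c; apply: color_of_three_neighbors cert.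
Qed.

End Guess.

(** * Guessing the ends at a root *)

Section RootSide.
Variables (n k : nat) (A : rel 'I_n) (col : {ffun 'I_n -> nat}).
Implicit Types (u v w r : 'I_n) (x : 'I_n -> 'I_n -> bool).

Local Notation linkA := (link A col).

(* Two neighbors of [r] with the same color lie at different ends, so [cs] need
   only tell the end of the first neighbor of each color. *)
Definition root_side (cs : seq nat) r u : bool :=
  [exists w : 'I_n, [&& w < u, linkA r w & col w == col u]] (+) (col u \in cs).

Lemma root_side_complete x r : (forall v, col v < k) -> consistent linkA x ->
  exists cs : {set 'I_k},
    forall u, linkA r u -> root_side [seq val c | c in cs] r u = x r u.
Proof.
move=> col_lt cx.
pose first u := linkA r u &&
  [forall w : 'I_n, (linkA r w && (col w == col u)) ==> (u <= w)].
have first_uniq u w : first u -> first w -> col u = col w -> u = w.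
  move=> /andP[link_u /forallP minu] /andP[link_w /forallP minw] uw;
    apply/val_inj/eqP.
  have := minu w; have := minw u.
  by rewrite link_u link_w uw eqxx /= eqn_leq => -> ->.
pose cs := [set c : 'I_k | [exists u, [&& first u, col u == c & x r u]]].
exists cs => u link_u; rewrite /root_side.
have [|w /andP[link_w /eqP wu] minw] :=
  @arg_minnP _ u (fun w => linkA r w && (col w == col u)) val.
  by rewrite link_u eqxx.
have first_w : first w.
  by rewrite /first link_w; apply/forallP => v; apply/implyP; rewrite wu; apply: minw.
have -> : (col u \in [seq val c | c in cs]) = x r w.
  apply/imageP/idP => [[c]|xw].
    rewrite inE => /existsP[v /and3P[first_v /eqP vc xv]] uc.
    by rewrite -(first_uniq v w) // vc -uc wu.
  exists (Ordinal (col_lt u)) => //; rewrite inE; apply/existsP; exists w.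
  by rewrite first_w wu eqxx.
have [<-|uw] := eqVneq w u.
  rewrite (_ : [exists _, _] = false) //;
    apply/existsP => -[v /and3P[vw link_v /eqP vcol]].
  by have := minw v; rewrite link_v vcol wu eqxx leqNgt vw => /(_ isT).
have apart : linkA w u = false by rewrite /link wu eqxx andbF.
have := cx r w u uw link_w link_u; rewrite apart (_ : [exists _, _] = true) /=.
  by case: (x r u); case: (x r w).
apply/existsP; exists w; rewrite link_w wu eqxx /= andbT ltn_neqAle uw.
by apply: minw; rewrite link_u eqxx.
Qed.

End RootSide.

(** * Programs with bounded loops *)

Declare Scope expr_scope.
Delimit Scope expr_scope with E.
Bind Scope expr_scope with expr.

Notation "$ r" := (Reg r) (at level 1, r at level 0, format "$ r") : expr_scope.
Notation "a .[ i ]" := (Read a i)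
  (at level 1, left associativity, format "a .[ i ]") : expr_scope.
Notation "x + y" := (Bin Add x y) : expr_scope.
Notation "x * y" := (Bin Mul x y) : expr_scope.
Notation "x %/ y" := (Bin Div x y) : expr_scope.
Notation "x == y" := (Bin Eq x y) : expr_scope.
Notation "x < y" := (Bin Lt x y) : expr_scope.
Notation "~~ x" := (Bin Eq x (Lit 0)) : expr_scope.
Notation "x && y" := (Bin Mul x y) (only parsing) : expr_scope.
Notation "x || y" := (Bin Add x y) (only parsing) : expr_scope.
Notation "a .[ i ; j ]" := (Read a (Bin Add (Bin Mul i (Reg 0)) j))
  (at level 1, left associativity, format "a .[ i ;  j ]") : expr_scope.

(* Loops are bounded by registers that are never written, so that the running
   time and the word size can be read off the program text. *)
Inductive prog :=
  | PSkip
  | PAssign of nat & expr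
  | PWrite of nat & expr & expr
  | PSeq of prog & prog
  | PIf of expr & prog & prog
  | PFor of nat & nat & prog.

Definition loop_test (r b : nat) : expr := $r < $b.

Definition increment (r : nat) : cmd := Assign r ($r + Lit 1)%E.

Fixpoint compile (p : prog) : cmd :=
  match p with
  | PSkip => Skip
  | PAssign r e => Assign r e
  | PWrite a i e => Write a i e
  | PSeq p1 p2 => Seq (compile p1) (compile p2)
  | PIf e p1 p2 => If e (compile p1) (compile p2)
  | PFor r b p =>
      Seq (Assign r (Lit 0))
          (While (loop_test r b) (Seq (compile p) (increment r)))
  end.

Fixpoint run (p : prog) (s : state) : state :=
  match p with
  | PSkip => s
  | PAssign r e => set_reg s r (eval s e)
  | PWrite a i e => set_arr s a (eval s i) (eval s e)
  | PSeq p1 p2 => run p2 (run p1 s)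
  | PIf e p1 p2 => if eval s e != 0 then run p1 s else run p2 s
  | PFor r b p =>
      iteri (reg s b) (fun i s' => set_reg (run p s') r i.+1) (set_reg s r 0)
  end.

Fixpoint keeps_reg (r : nat) (p : prog) : bool :=
  match p with
  | PSkip | PWrite _ _ _ => true
  | PAssign r' _ => r' != r
  | PSeq p1 p2 | PIf _ p1 p2 => keeps_reg r p1 && keeps_reg r p2
  | PFor r' _ p => (r' != r) && keeps_reg r p
  end.

Fixpoint keeps_arr (a : nat) (p : prog) : bool :=
  match p with
  | PSkip | PAssign _ _ => true
  | PWrite a' _ _ => a' != a
  | PSeq p1 p2 | PIf _ p1 p2 => keeps_arr a p1 && keeps_arr a p2
  | PFor _ _ p => keeps_arr a p
  end.

Lemma reg_run r p s : keeps_reg r p -> reg (run p s) r = reg s r.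
Proof.
elim: p s => [|r' e|a i e|p1 IH1 p2 IH2|e p1 IH1 p2 IH2|r' b p IH] s //=.
- by rewrite eq_sym => /negbTE->.
- by case/andP=> keep1 keep2; rewrite IH2 // IH1.
- by case/andP=> keep1 keep2; case: ifP => _; rewrite ?IH1 ?IH2.
- case/andP=> /negbTE r'r keep.
  by elim: (reg s b) => [|n IHn] /=; rewrite eq_sym r'r // IH.
Qed.

Lemma arr_run a p s i : keeps_arr a p -> arr (run p s) a i = arr s a i.
Proof.
elim: p s => [|r' e|a' j e|p1 IH1 p2 IH2|e p1 IH1 p2 IH2|r' b p IH] s //=.
- by rewrite eq_sym => /negbTE->.
- by case/andP=> keep1 keep2; rewrite IH2 // IH1.
- by case/andP=> keep1 keep2; case: ifP => _; rewrite ?IH1 ?IH2.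
- by move=> keep; elim: (reg s b) => [|n IHn] //=; rewrite IH.
Qed.

(** ** Word size and running time *)

Fixpoint no_growth (e : expr) : bool :=
  match e with
  | Lit _ | Reg _ | Read _ _ => true
  | Bin Add _ _ | Bin Mul _ _ => false
  | Bin Defs.Sub e _ | Bin Div e _ => no_growth e
  | Bin Eq _ _ | Bin Lt _ _ => true
  end.

(* The registers that may bound a loop are 0, 1 and 3, holding at most [N],
   [N ^ 2] and [2 * N]; elsewhere the degree is the junk value 0. *)
Definition bound_degree (b : nat) : nat := nth 0 [:: 1; 2; 0; 1] b.

Definition is_bound (b : nat) : bool := 0 < bound_degree b.

Fixpoint well_formed (p : prog) : bool :=
  match p with
  | PSkip => true
  | PAssign r e => ~~ is_bound r && no_growth e
  | PWrite _ _ e => no_growth e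
  | PSeq p1 p2 | PIf _ p1 p2 => well_formed p1 && well_formed p2
  | PFor r b p =>
      [&& ~~ is_bound r, is_bound b, keeps_reg r p & well_formed p]
  end.

Lemma keeps_bound b p : well_formed p -> is_bound b -> keeps_reg b p.
Proof.
move=> + bb; elim: p => //=.
- by move=> r e /andP[rb _]; apply: contra rb => /eqP->.
- by move=> p1 IH1 p2 IH2 /andP[/IH1-> /IH2->].
- by move=> e p1 IH1 p2 IH2 /andP[/IH1-> /IH2->].
- move=> r b' p IH /and4P[rb _ _ /IH->]; rewrite andbT.
  by apply: contra rb => /eqP->.
Qed.

Fixpoint max_literal (e : expr) : nat :=
  match e with
  | Lit v => v
  | Reg _ => 0
  | Read _ i => max_literal i
  | Bin _ e1 e2 => maxn (max_literal e1) (max_literal e2)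
  end.

Fixpoint leaves (e : expr) : nat :=
  match e with
  | Lit _ | Reg _ => 1
  | Read _ i => leaves i
  | Bin _ e1 e2 => leaves e1 + leaves e2
  end.

Fixpoint exprs (p : prog) : seq expr :=
  match p with
  | PSkip => [::]
  | PAssign _ e => [:: e]
  | PWrite _ i e => [:: i; e]
  | PSeq p1 p2 => exprs p1 ++ exprs p2
  | PIf e p1 p2 => e :: exprs p1 ++ exprs p2
  | PFor _ _ p => exprs p
  end.

Fixpoint degree (p : prog) : nat :=
  match p with
  | PSkip | PAssign _ _ | PWrite _ _ _ => 0
  | PSeq p1 p2 | PIf _ p1 p2 => maxn (degree p1) (degree p2)
  | PFor _ b p => bound_degree b + degree p
  end.

Fixpoint coefficient (p : prog) : nat :=
  match p with
  | PSkip => 1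
  | PAssign _ e => (cost e).+1
  | PWrite _ i e => (cost i + cost e).+1
  | PSeq p1 p2 => coefficient p1 + coefficient p2
  | PIf e p1 p2 => (cost e + (coefficient p1 + coefficient p2)).+1
  | PFor _ _ p => 2 * coefficient p + 22
  end.

Definition halts_within (W : nat) (p : cmd) (s s' : state) (T : nat) : Prop :=
  exists2 t, exec W p s s' t & t <= T.

Definition memory_below (B : nat) (s : state) : Prop :=
  (forall r, reg s r < B) /\ (forall a i, arr s a i < B).

Lemma memory_below_set_reg B s r v :
  v < B -> memory_below B s -> memory_below B (set_reg s r v).
Proof. by move=> vB [rB aB]; split=> //= r'; case: ifP. Qed.

Lemma memory_below_set_arr B s a i v :
  v < B -> memory_below B s -> memory_below B (set_arr s a i v).
Proof. by move=> vB [rB aB]; split=> //= a' i'; case: ifP. Qed.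

Lemma leaves_gt0 e : 0 < leaves e.
Proof. by elim: e => //= o e1 IH1 e2 IH2; rewrite addn_gt0 IH1. Qed.

Lemma eval_op_lt_mul o x y X Y :
  1 < X -> 1 < Y -> x < X -> y < Y -> eval_op o x y < X * Y.
Proof.
move=> X1 Y1 xX yY; have x_lt : x < X * Y by nia.
case: o => /=; first by nia.
- exact: leq_ltn_trans (leq_subr _ _) x_lt.
- by nia.
- exact: leq_ltn_trans (leq_div _ _) x_lt.
- by apply: leq_ltn_trans (leq_b1 _) _; nia.
- by apply: leq_ltn_trans (leq_b1 _) _; nia.
Qed.

Section WordSize.
Variables (B W : nat).
Hypothesis B_gt1 : 1 < B.

Definition small_expr (e : expr) : bool :=
  (max_literal e < B) && (B ^ leaves e <= W).

Lemma ltn_pow_leaves e : 1 < B ^ leaves e.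
Proof. by rewrite -[1](expn0 B) ltn_exp2l ?leaves_gt0. Qed.

Lemma eval_lt s e :
  memory_below B s -> max_literal e < B -> eval s e < B ^ leaves e.
Proof.
case=> rB aB; elim: e => [v|r|a i IH|o e1 IH1 e2 IH2] /=; rewrite ?expn1 //.
- move=> _; apply: leq_trans (aB _ _) _.
  by rewrite -[leqLHS]expn1 leq_exp2l ?leaves_gt0.
- rewrite gtn_max => /andP[/IH1 lt1 /IH2 lt2]; rewrite expnD.
  by apply: eval_op_lt_mul => //; apply: ltn_pow_leaves.
Qed.

Lemma small_expr_fits s e : memory_below B s -> small_expr e -> fits W s e.
Proof.
move=> sB /andP[]; elim: e => [v|r|a i IH|o e1 IH1 e2 IH2] lit le_W;
  have /= lt := eval_lt sB lit; rewrite /= (leq_trans lt) //=; first by rewrite IH.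
move: lit le_W; rewrite /= gtn_max => /andP[lit1 lit2] le_W.
rewrite IH1 // ?IH2 //; apply: leq_trans le_W;
  by rewrite leq_exp2l // ?leq_addr ?leq_addl.
Qed.

Lemma no_growth_lt s e :
  memory_below B s -> max_literal e < B -> no_growth e -> eval s e < B.
Proof.
case=> rB aB; elim: e => //= o e1 IH1 e2 _; rewrite gtn_max.
case/andP=> lit1 _; case: o => //= grow.
- by apply: leq_ltn_trans (leq_subr _ _) _; apply: IH1.
- by apply: leq_ltn_trans (leq_div _ _) _; apply: IH1.
- exact: leq_ltn_trans (leq_b1 _) B_gt1.
- exact: leq_ltn_trans (leq_b1 _) B_gt1.
Qed.

Lemma exec_write a s i e : small_expr i -> small_expr e -> memory_below B s ->
  halts_within W (Write a i e) s (set_arr s a (eval s i) (eval s e))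
    (cost i + cost e).+1.
Proof.
move=> small_i small_e sB; exists (cost i + cost e).+1 => //.
by apply: ExecWrite; apply: small_expr_fits.
Qed.

End WordSize.

Lemma halts_seq W c1 c2 s1 s2 s3 T1 T2 :
  halts_within W c1 s1 s2 T1 -> halts_within W c2 s2 s3 T2 ->
  halts_within W (Seq c1 c2) s1 s3 (T1 + T2).
Proof.
move=> [t1 run1 le1] [t2 run2 le2]; exists (t1 + t2); last exact: leq_add.
exact: ExecSeq run1 run2.
Qed.

Lemma halts_if W s s' e c1 c2 T :
  fits W s e -> halts_within W (if eval s e != 0 then c1 else c2) s s' T ->
  halts_within W (If e c1 c2) s s' (cost e + T).+1.
Proof.
move=> fit [t run_t le_t]; exists (cost e + t).+1; last by rewrite ltnS leq_add2l.
exact: ExecIf.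
Qed.

Lemma halts_weaken W c s s' T T' :
  T <= T' -> halts_within W c s s' T -> halts_within W c s s' T'.
Proof. by move=> le [t run_t le_t]; exists t => //; apply: leq_trans le. Qed.

(* An iteration costs the body, 4 for the increment and 4 for the test. *)
Lemma halts_while W r b c (st : nat -> state) N T :
  1 < W -> N < W ->
  (forall i, i <= N -> reg (st i) r = i /\ reg (st i) b = N) ->
  (forall i, i < N -> exists2 s, st i.+1 = set_reg s r i.+1 &
     reg s r = i /\ halts_within W c (st i) s T) ->
  halts_within W (While (loop_test r b) (Seq c (increment r))) (st 0) (st N)
    (N * (T + 8) + 4).
Proof.
move=> W_gt1 NW regs body.
have fit i : i <= N -> fits W (st i) (loop_test r b).
  move=> iN; have [ri bi] := regs i iN; rewrite /= ri bi NW (leq_ltn_trans iN NW).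
  by rewrite !andbT (leq_ltn_trans (leq_b1 _) W_gt1).
suff step j : j <= N -> halts_within W
    (While (loop_test r b) (Seq c (increment r))) (st (N - j)) (st N)
    (j * (T + 8) + 4).
  by rewrite -{1}(subnn N); apply: step.
elim: j => [|j IH] jN.
  have [rN bN] := regs N (leqnn N); exists 4 => //; rewrite subn0.
  by apply: ExecWhileStop; rewrite ?fit //= rN bN ltnn.
have [t' run_t' le_t'] := IH (ltnW jN).
set i := N - j.+1; have iN : i < N by rewrite /i; lia.
have [ri bi] := regs i (ltnW iN); have [s s_next [rs [t run_t le_t]]] := body i iN.
have next_i : N - j = i.+1 by rewrite /i; lia.
exists (3 + (t + 4) + t').+1; last by lia.
apply: ExecWhileStep run_t'; first exact: fit (ltnW iN).
  by rewrite /= ri bi iN.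
apply: ExecSeq run_t _; rewrite next_i s_next.
have := @ExecAssign W s r ($r + Lit 1)%E; rewrite /= rs addn1.
by apply; rewrite W_gt1 !(leq_ltn_trans _ NW) // ltnW.
Qed.

Section Compile.
Variables (B W N : nat).
Hypotheses (B_gt1 : 1 < B) (B_le_W : B <= W) (N_gt0 : 0 < N).

Definition bounds_hold (s : state) : Prop :=
  forall b, is_bound b -> reg s b <= 2 * N ^ bound_degree b.

Lemma bounds_hold_run p s : well_formed p -> bounds_hold s -> bounds_hold (run p s).
Proof. by move=> wf hs b bb; rewrite reg_run ?hs // keeps_bound. Qed.

Lemma bounds_hold_set_reg s r v :
  ~~ is_bound r -> bounds_hold s -> bounds_hold (set_reg s r v).
Proof.
by move=> rb hs b bb /=; case: eqP => [br|_]; [rewrite -br bb in rb | apply: hs].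
Qed.

Definition runs_within (p : prog) (s : state) : Prop :=
  memory_below B (run p s) /\
  halts_within W (compile p) s (run p s) (coefficient p * N ^ degree p).

Lemma leq_coefficient c d d' : d <= d' -> c * N ^ d <= c * N ^ d'.
Proof. by move=> le; rewrite leq_mul2l leq_pexp2l ?orbT. Qed.

Lemma runs_within_seq p1 p2 s :
  runs_within p1 s -> runs_within p2 (run p1 s) -> runs_within (PSeq p1 p2) s.
Proof.
move=> [_ run1] [below2 run2]; split=> //=.
apply: halts_weaken (halts_seq run1 run2).
by rewrite mulnDl leq_add // leq_coefficient ?leq_maxl ?leq_maxr.
Qed.

Lemma runs_within_if e p1 p2 s :
  fits W s e -> runs_within p1 s -> runs_within p2 s ->
  runs_within (PIf e p1 p2) s.
Proof.
move=> fit [below1 run1] [below2 run2]; split=> /=; first by case: ifP.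
set d := maxn _ _.
have pow_gt0 : 0 < N ^ d by rewrite expn_gt0 N_gt0.
have le1 : coefficient p1 * N ^ degree p1 <= coefficient p1 * N ^ d.
  by rewrite leq_coefficient ?leq_maxl.
have le2 : coefficient p2 * N ^ degree p2 <= coefficient p2 * N ^ d.
  by rewrite leq_coefficient ?leq_maxr.
set c := coefficient p1 + coefficient p2.
apply: (@halts_weaken _ _ _ _ (cost e + c * N ^ d).+1).
  by move: (N ^ d) pow_gt0 => X; nia.
apply: halts_if => //; rewrite mulnDl; case: ifP => _.
  by apply: halts_weaken run1; apply: leq_trans le1 (leq_addr _ _).
by apply: halts_weaken run2; apply: leq_trans le2 (leq_addl _ _).
Qed.

Lemma runs_within_for r b p s :
  well_formed (PFor r b p) -> memory_below B s -> bounds_hold s ->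
  (forall s', memory_below B s' -> bounds_hold s' -> runs_within p s') ->
  runs_within (PFor r b p) s.
Proof.
rewrite /= => /and4P[rb bb keep_r wf] sB bounds body.
have keep_b : keeps_reg b p by apply: keeps_bound.
have br : (b == r) = false by apply: contraNF rb => /eqP<-.
have lt_B : reg s b < B by case: sB.
pose st i := iteri i (fun i s' => set_reg (run p s') r i.+1) (set_reg s r 0).
have inv i : i <= reg s b -> [/\ memory_below B (st i), bounds_hold (st i),
    reg (st i) r = i & reg (st i) b = reg s b].
  elim: i => [|i IH] le_b.
    split; [| exact: bounds_hold_set_reg | by rewrite /= eqxx | by rewrite /= br].
    by apply: memory_below_set_reg => //; apply: ltnW.
  have [below bd ri bi] := IH (ltnW le_b); have [below' _] := body _ below bd.
  split; [| |by rewrite /= eqxx |by rewrite /= br reg_run].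
    by apply: memory_below_set_reg => //; apply: leq_ltn_trans lt_B.
  by apply: bounds_hold_set_reg => //; apply: bounds_hold_run.
split; first by case: (inv _ (leqnn (reg s b))).
have [||||t run_t le_t] := @halts_while W r b (compile p) st (reg s b)
    (coefficient p * N ^ degree p).
- exact: leq_trans B_le_W.
- exact: leq_trans B_le_W.
- by move=> i /inv[].
- move=> i lt_b; have [below bd ri _] := inv i (ltnW lt_b).
  exists (run p (st i)) => //; split; first by rewrite reg_run.
  by case: (body _ below bd).
exists (2 + t).
  apply: ExecSeq run_t; apply: ExecAssign => /=; rewrite andbT.
  exact: leq_trans (ltnW B_gt1) B_le_W.
rewrite /= expnD; apply: leq_trans (leq_add (leqnn 2) le_t) _.
have := bounds b bb; have : 0 < N ^ degree p by rewrite expn_gt0 N_gt0.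
have : 0 < N ^ bound_degree b by rewrite expn_gt0 N_gt0.
by move: (N ^ _) (N ^ _) => X Y; nia.
Qed.

Lemma compile_runs_within p s :
  well_formed p -> all (small_expr B W) (exprs p) ->
  memory_below B s -> bounds_hold s -> runs_within p s.
Proof.
elim: p s => [|r e|a i e|p1 IH1 p2 IH2|e p1 IH1 p2 IH2|r b p IH] s.
- by move=> _ _ below _; split=> //; exists 1; rewrite ?muln1 //; apply: ExecSkip.
- case/andP=> _ grow; rewrite /= andbT => small below _; split=> /=.
    apply: memory_below_set_reg => //; apply: no_growth_lt => //.
    by case/andP: small.
  exists (cost e).+1; last by rewrite muln1.
  by apply: ExecAssign; apply: small_expr_fits small.
- move=> grow /= /and3P[small_i small_e _] below _; split=> /=.
    apply: memory_below_set_arr => //; apply: no_growth_lt => //.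
    by case/andP: small_e.
  by rewrite muln1; apply: exec_write small_e below.
- move=> /= /andP[wf1 wf2]; rewrite all_cat => /andP[small1 small2] below bounds.
  have run1 := IH1 s wf1 small1 below bounds.
  apply: runs_within_seq => //; apply: IH2 => //; first by case: run1.
  exact: bounds_hold_run.
- move=> /= /andP[wf1 wf2] /andP[small]; rewrite all_cat.
  case/andP=> small1 small2 below bounds; apply: runs_within_if.
  + exact: small_expr_fits small.
  + exact: IH1.
  + exact: IH2.
- move=> wf small below bounds; apply: runs_within_for => // s' below' bounds'.
  by apply: IH => //; case/and4P: wf.
Qed.

End Compile.

Lemma all_leq_bigmax T (f : T -> nat) (s : seq T) :
  all (fun x => f x <= \max_(y <- s) f y) s.
Proof.
elim: s => //= x s IH; rewrite big_cons leq_maxl.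
by apply: sub_all IH => y le; rewrite leq_max le orbT.
Qed.

Lemma compile_polynomial p : well_formed p ->
  exists c, forall M N s,
    1 < M -> 0 < N -> memory_below (M ^ 2) s -> bounds_hold N s ->
    M ^ 2 <= M ^ c /\
    halts_within (M ^ c) (compile p) s (run p s) (coefficient p * N ^ degree p).
Proof.
move=> wf; pose l := \max_(e <- exprs p) max_literal e.
pose z := \max_(e <- exprs p) leaves e.
exists ((l + 2) * z.+1) => M N s M_gt1 N_gt0 below bounds.
have M_gt0 : 0 < M := ltnW M_gt1; pose B := M ^ (l + 2).
have sqr_le_B : M ^ 2 <= B by rewrite leq_pexp2l // leq_addl.
have B_gt1 : 1 < B by apply: leq_trans sqr_le_B; rewrite (ltn_exp2l 0).
have lB : l < B.
  by apply: leq_trans (ltn_expl l M_gt1) _; rewrite leq_pexp2l ?leq_addr.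
have B_le_W : B <= B ^ z.+1 by rewrite -{1}[B]expn1 leq_pexp2l // ltnW.
rewrite expnM -/B.
split; first exact: leq_trans B_le_W.
have small : all (small_expr B (B ^ z.+1)) (exprs p).
  have : all (predI (fun e => max_literal e <= l) (fun e => leaves e <= z)) (exprs p).
    by rewrite all_predI !all_leq_bigmax.
  apply: sub_all => e /andP[le_l le_z].
  by rewrite /small_expr (leq_ltn_trans le_l lB) leq_pexp2l ?(ltnW B_gt1) ?leqW.
have belowB : memory_below B s.
  by case: below => rB aB; split=> *; apply: leq_trans sqr_le_B.
by case: (compile_runs_within B_gt1 B_le_W N_gt0 wf small belowB bounds).
Qed.

(** * Reasoning about programs *)

Arguments run : simpl never.

Lemma run_skip s : run PSkip s = s. Proof. by []. Qed.

Lemma run_assign r e s : run (PAssign r e) s = set_reg s r (eval s e).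
Proof. by []. Qed.

Lemma run_write a i e s : run (PWrite a i e) s = set_arr s a (eval s i) (eval s e).
Proof. by []. Qed.

Lemma run_seq p q s : run (PSeq p q) s = run q (run p s). Proof. by []. Qed.

Definition runE := (run_skip, run_assign, run_write, run_seq).

Definition seqs (ps : seq prog) : prog := foldr PSeq PSkip ps.

Lemma run_seqs_cons p ps s : run (seqs (p :: ps)) s = run (seqs ps) (run p s).
Proof. by []. Qed.

Lemma run_seqs_nil s : run (seqs [::]) s = s. Proof. by []. Qed.

Definition run_seqsE := (run_seqs_cons, run_seqs_nil).

Lemma keeps_reg_seqs r ps : keeps_reg r (seqs ps) = all (keeps_reg r) ps.
Proof. by elim: ps => //= p ps ->. Qed.

Lemma keeps_arr_seqs a ps : keeps_arr a (seqs ps) = all (keeps_arr a) ps.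
Proof. by elim: ps => //= p ps ->. Qed.

Lemma well_formed_seqs ps : well_formed (seqs ps) = all well_formed ps.
Proof. by elim: ps => //= p ps ->. Qed.

Lemma degree_seqs d ps : (degree (seqs ps) <= d) = all (fun p => degree p <= d) ps.
Proof. by elim: ps => //= p ps <-; rewrite geq_max. Qed.

Definition frame (p : prog) (s s' : state) : Prop :=
  (forall r, keeps_reg r p -> reg s' r = reg s r) /\
  (forall a i, keeps_arr a p -> arr s' a i = arr s a i).

Lemma frame_run p s : frame p s (run p s).
Proof. by split=> [r|a i]; [apply: reg_run | apply: arr_run]. Qed.

Lemma run_for (I : nat -> state -> Prop) r b p s :
  keeps_reg r p -> (forall i s' v, I i s' -> I i (set_reg s' r v)) -> I 0 s ->
  (forall i s', i < reg s b -> frame (PFor r b p) s s' -> reg s' r = i ->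
     I i s' -> I i.+1 (run p s')) ->
  I (reg s b) (run (PFor r b p) s).
Proof.
move=> keep stable init step.
pose st i := iteri i (fun i s' => set_reg (run p s') r i.+1) (set_reg s r 0).
suff inv i : i <= reg s b ->
    [/\ frame (PFor r b p) s (st i), reg (st i) r = i & I i (st i)].
  by case: (inv _ (leqnn _)).
elim: i => [|i IH] le_b.
  split; [|by rewrite /= eqxx|exact: stable].
  by split=> //= x /andP[/negbTE]; rewrite eq_sym => ->.
have [fr ri inv_i] := IH (ltnW le_b); split; first split.
- by move=> x /= /andP[/negbTE neq keep_x];
    rewrite eq_sym neq reg_run // fr.1 //= neq.
- by move=> a j keep_a; rewrite /= arr_run // fr.2.
- by rewrite /= eqxx.
- by apply: stable; apply: step.
Qed.

Lemma run_for_cells n r a p (cell value : 'I_n -> nat) s :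
  reg s 0 = n -> keeps_reg r p -> injective cell ->
  (forall (i : 'I_n) s', frame (PFor r 0 p) s s' -> reg s' r = i ->
     (forall j, (forall i' : 'I_n, i' < i -> j != cell i') ->
        arr s' a j = arr s a j) ->
     forall j, arr (run p s') a j = if j == cell i then value i else arr s' a j) ->
  let s' := run (PFor r 0 p) s in
  (forall i, arr s' a (cell i) = value i) /\
  (forall j, (forall i, j != cell i) -> arr s' a j = arr s a j).
Proof.
move=> sn keep cell_inj body.
pose I m s' := (forall i : 'I_n, i < m -> arr s' a (cell i) = value i) /\
  (forall j, (forall i : 'I_n, i < m -> j != cell i) -> arr s' a j = arr s a j).
suff [written rest] : I (reg s 0) (run (PFor r 0 p) s).
  by split=> [i|j other]; [apply: written; rewrite sn | apply: rest].
apply: run_for => // m s'; rewrite sn => lt_n fr rm [written rest].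
have step := body (Ordinal lt_n) s' fr rm rest.
split=> [i|j other]; rewrite step.
  rewrite (inj_eq cell_inj) -val_eqE ltnS leq_eqVlt /=.
  case: eqP => [im _|_ /written //].
  by rewrite (_ : Ordinal lt_n = i) //; apply: val_inj.
by rewrite (negbTE (other (Ordinal lt_n) _)) // rest // => i im; apply/other/leqW.
Qed.

Lemma arr_for_cells n r a p (value : 'I_n -> nat) s :
  reg s 0 = n -> keeps_reg r p ->
  (forall (i : 'I_n) s', frame (PFor r 0 p) s s' -> reg s' r = i ->
     arr s' a i = arr s a i ->
     forall j, arr (run p s') a j = if j == i then value i else arr s' a j) ->
  forall i : 'I_n, arr (run (PFor r 0 p) s) a i = value i.
Proof.
move=> sn keep body.
have [|written _ //] := run_for_cells (a := a) (value := value) sn keep val_inj.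
move=> i s' fr si rest; apply: body => //; apply: rest => i'.
by rewrite eq_sym => /ltn_eqF->.
Qed.

(** ** Expressions as formulas *)

Definition truth (e : expr) : expr := ~~ ~~ e.

Definition one_of (cs : seq nat) (e : expr) : expr :=
  foldr (fun c f => (e == Lit c) || f)%E (Lit 0) cs.

Definition test (s : state) (e : expr) : bool := eval s e != 0.

Lemma test_and s e1 e2 : test s (e1 && e2) = test s e1 && test s e2.
Proof. by rewrite /test /= muln_eq0 negb_or. Qed.

Lemma test_or s e1 e2 : test s (e1 || e2) = test s e1 || test s e2.
Proof. by rewrite /test /= addn_eq0 negb_and. Qed.

Lemma test_eq s e1 e2 : test s (e1 == e2) = (eval s e1 == eval s e2).
Proof. by rewrite /test /= eqb0 negbK. Qed.

Lemma test_lt s e1 e2 : test s (e1 < e2) = (eval s e1 < eval s e2).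
Proof. by rewrite /test /= eqb0 negbK. Qed.

Lemma test_not s e : test s (~~ e) = ~~ test s e.
Proof. by rewrite test_eq negbK. Qed.

Lemma eval_eq s e1 e2 : eval s (e1 == e2) = (eval s e1 == eval s e2) :> nat.
Proof. by []. Qed.

Lemma eval_not s e : eval s (~~ e) = ~~ test s e :> nat.
Proof. by rewrite /test negbK. Qed.

Lemma eval_truth s e : eval s (truth e) = test s e :> nat.
Proof. by rewrite eval_not test_not negbK. Qed.

Lemma test_one_of s cs e : test s (one_of cs e) = (eval s e \in cs).
Proof. by elim: cs => //= c cs IH; rewrite test_or test_eq IH inE. Qed.

Lemma run_if e p q s : run (PIf e p q) s = if test s e then run p s else run q s.
Proof. by []. Qed.

(** ** Searching *)

Local Notation r_flag := 5 (only parsing).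

Definition find_last (r b : nat) (e : expr) : prog :=
  PSeq (PAssign r_flag (Lit 0)) (PFor r b (PIf e (PAssign r_flag $r) PSkip)).

Lemma bigmax_ordS n (P : pred 'I_n) m (mn : m < n) :
  \max_(i < n | P i && (i < m.+1)) i =
  if P (Ordinal mn) then m else \max_(i < n | P i && (i < m)) i.
Proof.
case: ifP => Pm.
  apply/eqP; rewrite eqn_leq; apply/andP; split.
    by apply/bigmax_leqP => i /andP[_]; rewrite ltnS.
  by apply: (leq_bigmax_cond (Ordinal mn)); rewrite Pm ltnS leqnn.
apply: eq_bigl => i; rewrite ltnS leq_eqVlt; case: eqP => [im|] //=.
by rewrite (_ : i = Ordinal mn) ?Pm //; apply: val_inj.
Qed.

Lemma reg_find_last n r b e (P : pred 'I_n) s :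
  r != r_flag -> b != r_flag -> reg s b = n ->
  (forall (i : 'I_n) s', frame (find_last r b e) s s' -> reg s' r = i ->
     test s' e = P i) ->
  reg (run (find_last r b e) s) r_flag = \max_(i < n | P i) i.
Proof.
move=> rf bf sb testP; rewrite run_seq; set s1 := run _ s.
have s1b : reg s1 b = n by rewrite reg_run //= eq_sym.
pose I m s' := reg s' r_flag = \max_(i < n | P i && (i < m)) i.
suff -> : I (reg s1 b) (run (PFor r b (PIf e (PAssign r_flag $r) PSkip)) s1).
  by apply: eq_bigl => i; rewrite s1b ltn_ord andbT.
apply: run_for.
- by rewrite /= eq_sym rf.
- by move=> i s' v; rewrite /I /= eq_sym (negbTE rf).
- by rewrite /I big1 // => i /andP[].
move=> m s'; rewrite s1b => mn fr rm; rewrite /I => flag.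
rewrite bigmax_ordS run_if (testP (Ordinal mn)) //; last first.
  case: fr => fr_reg fr_arr; split=> [x|a j] keep.
    by rewrite fr_reg ?reg_run //; case/andP: keep.
  by rewrite fr_arr // arr_run.
by case: (P _); rewrite !runE //= rm.
Qed.

Fixpoint search (vs : seq nat) (e : expr) (v : nat) : prog :=
  if vs is r :: vs' then PFor r 0 (search vs' e v)
  else PIf e (PAssign r_flag (Lit v)) PSkip.

Fixpoint satisfiable (n : nat) (vs : seq nat) (e : expr) (s : state) : bool :=
  if vs is r :: vs' then
    [exists i : 'I_n, satisfiable n vs' e (set_reg s r i)]
  else test s e.

Fixpoint expr_regs (e : expr) : seq nat :=
  match e with
  | Lit _ => [::]
  | Reg r => [:: r]
  | Read _ i => expr_regs i
  | Bin _ e1 e2 => expr_regs e1 ++ expr_regs e2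
  end.

Definition agree_off (X : seq nat) (s s' : state) : Prop :=
  (forall a i, arr s a i = arr s' a i) /\
  (forall r, r \notin X -> reg s r = reg s' r).

Lemma eval_agree X s s' e :
  agree_off X s s' -> all [predC X] (expr_regs e) -> eval s e = eval s' e.
Proof.
case=> same_arr same_reg; elim: e => //= [r|a i IH|o e1 IH1 e2 IH2].
- by rewrite andbT => /same_reg.
- by move=> /IH->.
- by rewrite all_cat => /andP[/IH1-> /IH2->].
Qed.

Lemma agree_off_set_reg X s s' r v : agree_off X s s' ->
  agree_off (filter (predC1 r) X) (set_reg s r v) (set_reg s' r v).
Proof.
case=> same_arr same_reg; split=> //= x; case: eqVneq => // xr.
by rewrite mem_filter /= xr => /same_reg.
Qed.

Lemma satisfiable_agree n X vs e s s' :
  agree_off X s s' -> all (fun r => (r \in vs) || (r \notin X)) (expr_regs e) ->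
  satisfiable n vs e s = satisfiable n vs e s'.
Proof.
elim: vs X s s' => [|r vs IH] X s s' agree off /=.
  by rewrite /test (eval_agree agree).
apply: eq_existsb => i; apply: IH (agree_off_set_reg r i agree) _.
apply: sub_all off => x; rewrite inE mem_filter /= negb_and negbK.
by case: (x == r) => /=; rewrite ?orbT.
Qed.

Lemma keeps_reg_search r vs e v :
  r \notin r_flag :: vs -> keeps_reg r (search vs e v).
Proof.
elim: vs => [|x vs IH]; first by rewrite inE /= andbT eq_sym.
rewrite /= !inE !negb_or => /and3P[r_neq_flag r_neq_x r_vs].
by rewrite eq_sym r_neq_x IH // inE negb_or r_neq_flag.
Qed.

Lemma keeps_arr_search a vs e v : keeps_arr a (search vs e v).
Proof. by elim: vs. Qed.

Lemma existsb_ordS n m (P : pred 'I_n) (mn : m < n) :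
  [exists i : 'I_n, (i < m.+1) && P i] =
  [exists i : 'I_n, (i < m) && P i] || P (Ordinal mn).
Proof.
apply/existsP/orP => [[i]|[/existsP[i /andP[im Pi]]|Pm]].
- rewrite ltnS leq_eqVlt => /andP[/predU1P[im|im] Pi].
    by right; rewrite (_ : Ordinal mn = i) //; apply: val_inj.
  by left; apply/existsP; exists i; rewrite im.
- by exists i; rewrite ltnW.
- by exists (Ordinal mn); rewrite ltnSn.
Qed.

Lemma reg_search n vs e v s :
  reg s 0 = n -> uniq (r_flag :: vs) -> 0 \notin vs -> r_flag \notin expr_regs e ->
  reg (run (search vs e v) s) r_flag =
    if satisfiable n vs e s then v else reg s r_flag.
Proof.
elim: vs s => [|r vs IH] s sn.
  by move=> _ _ _; rewrite /= run_if; case: ifP.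
rewrite 2!cons_uniq inE negb_or => /andP[/andP[fr fvs] /andP[rvs uvs]].
rewrite inE negb_or => /andP[r0 vs0] fe.
pose sat (i : 'I_n) := satisfiable n vs e (set_reg s r i).
pose I m s' := reg s' r_flag =
  if [exists i : 'I_n, (i < m) && sat i] then v else reg s r_flag.
suff -> : I (reg s 0) (run (search (r :: vs) e v) s).
  by rewrite sn /=; congr (if _ then _ else _); apply: eq_existsb => i;
    rewrite ltn_ord.
apply: run_for.
- by rewrite keeps_reg_search // inE negb_or eq_sym fr.
- by move=> i s' w; rewrite /I /= (negbTE fr).
- by rewrite /I; case: existsP => [[]|].
move=> m s' mn [fr_reg fr_arr] rm; rewrite sn in mn; rewrite /I existsb_ordS => flag.
have -> : sat (Ordinal mn) = satisfiable n vs e s'.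
  apply: (@satisfiable_agree _ (r_flag :: vs)).
    split=> [a i|x]; first by rewrite fr_arr //= keeps_arr_search.
    move=> xvs; rewrite /=; case: eqVneq => [->|xr]; first by rewrite rm.
    by rewrite fr_reg //= eq_sym xr keeps_reg_search.
  apply/allP=> x xe; rewrite inE; case: (x \in vs) => //=; rewrite orbF.
  by apply: contraNneq fe => <-.
rewrite IH //; [|by rewrite fr_reg //= eq_sym r0 keeps_reg_search // inE negb_or vs0|
  by rewrite cons_uniq fvs uvs].
by rewrite flag; case: existsP; case: satisfiable.
Qed.

(** * The algorithm *)

(* Vertices are numbered, colors are the numbers below [k], and matrices are
   stored by rows. The color [k] marks an uncolored vertex, [a_side] holds the
   ends guessed for the component of [r_root] that lies in [a_reached], and
   [a_solution] the ends found for the components in [a_solved]. *)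
Local Notation r_vertices := 0 (only parsing).
Local Notation r_edges := 1 (only parsing).
Local Notation r_accept := 2 (only parsing).
Local Notation r_points := 3 (only parsing).
Local Notation r_root_edges := 4 (only parsing).
Local Notation r_u := 6 (only parsing).
Local Notation r_v := 7 (only parsing).
Local Notation r_w := 8 (only parsing).
Local Notation r_x := 9 (only parsing).
Local Notation r_root := 10 (only parsing).

Local Notation a_tail := 0 (only parsing).
Local Notation a_head := 1 (only parsing).
Local Notation a_root_tail := 2 (only parsing).
Local Notation a_root_head := 3 (only parsing).
Local Notation a_root_color := 4 (only parsing).
Local Notation a_adj := 5 (only parsing).
Local Notation a_color := 6 (only parsing).
Local Notation a_crowded := 7 (only parsing).
Local Notation a_reached := 8 (only parsing).
Local Notation a_side := 9 (only parsing).
Local Notation a_solved := 10 (only parsing).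
Local Notation a_solution := 11 (only parsing).

Definition read_graph : prog :=
  PFor r_u r_edges
    (PSeq (PWrite a_adj (a_tail.[$r_u] * $r_vertices + a_head.[$r_u]) (Lit 1))
          (PWrite a_adj (a_head.[$r_u] * $r_vertices + a_tail.[$r_u]) (Lit 1))).

Definition color_last_vertex (k c : nat) : prog :=
  PSeq (find_last r_u r_vertices (a_color.[$r_u] == Lit k))
       (PIf (a_color.[$r_flag] == Lit k) (PWrite a_color $r_flag (Lit c)) PSkip).

Definition crowded_test (c : nat) : expr :=
  (a_adj.[$r_u; $r_v] && (a_color.[$r_v] == Lit c)) &&
  (a_adj.[$r_u; $r_w] && (a_color.[$r_w] == Lit c)) &&
  (a_adj.[$r_u; $r_x] && (a_color.[$r_x] == Lit c)) &&
  (~~ ($r_v == $r_w) && ~~ ($r_w == $r_x) && ~~ ($r_x == $r_v)).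

Definition mark_crowded (c : nat) : prog :=
  PFor r_u r_vertices
    (seqs [:: PAssign r_flag (Lit 0);
              search [:: r_v; r_w; r_x] (crowded_test c) 1;
              PWrite a_crowded $r_u $r_flag]).

Definition absorb_crowded (k c : nat) : prog :=
  PFor r_u r_vertices
    (PIf ((a_color.[$r_u] == Lit k) && a_crowded.[$r_u])
         (PWrite a_color $r_u (Lit c)) PSkip).

Definition guess_color (k c : nat) : prog :=
  seqs [:: color_last_vertex k c; mark_crowded c; absorb_crowded k c].

Definition guess_colors (k : nat) (g : seq nat) : prog :=
  PSeq (PFor r_u r_vertices (PWrite a_color $r_u (Lit k)))
       (seqs [seq guess_color k c | c <- g]).

Definition linked (u v : expr) : expr :=
  a_adj.[u; v] && ~~ (a_color.[u] == a_color.[v]).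

Definition start_at_root (cs : seq nat) : prog :=
  PSeq (PFor r_u r_vertices (PWrite a_reached $r_u ($r_u == $r_root)))
       (PFor r_u r_vertices
          (seqs [:: PAssign r_flag (Lit 0);
                    search [:: r_v]
                      (($r_v < $r_u) && linked $r_root $r_v &&
                       (a_color.[$r_v] == a_color.[$r_u])) 1;
                    PWrite a_side ($r_root * $r_vertices + $r_u)
                      (~~ $r_flag == truth (one_of cs a_color.[$r_u]))])).

Definition propagate_row : prog :=
  PFor r_x r_vertices
    (PWrite a_side ($r_v * $r_vertices + $r_x)
       (~~ (($r_x == $r_w) ||
            linked $r_w $r_x &&
            (truth a_side.[$r_w; $r_x] == truth a_side.[$r_w; $r_v])))).

Definition propagate_edge : prog :=
  PIf (~~ a_reached.[$r_v] && a_reached.[$r_w] && linked $r_v $r_w)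
    (PSeq (PWrite a_reached $r_v (Lit 1)) propagate_row)
    PSkip.

Definition propagate_vertex : prog := PFor r_w r_vertices propagate_edge.

Definition propagate_round : prog := PFor r_v r_vertices propagate_vertex.

Definition propagate : prog := PFor r_u r_vertices propagate_round.

Definition inconsistent_test : expr :=
  a_reached.[$r_u] && ~~ ($r_v == $r_w) && linked $r_u $r_v && linked $r_u $r_w &&
  ((truth a_side.[$r_u; $r_v] == truth a_side.[$r_u; $r_w]) ==
   ~~ (linked $r_v $r_w && (truth a_side.[$r_v; $r_u] == truth a_side.[$r_v; $r_w]))).

Definition check_component : prog :=
  PSeq (PAssign r_flag (Lit 1)) (search [:: r_u; r_v; r_w] inconsistent_test 0).

Definition mark_solved : prog :=
  PFor r_u r_vertices
    (PIf a_reached.[$r_u] (PWrite a_solved $r_u (Lit 1)) PSkip).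

Definition copy_sides : prog :=
  PFor r_u r_vertices
    (PIf a_reached.[$r_u]
       (PFor r_v r_vertices
          (PWrite a_solution ($r_u * $r_vertices + $r_v) a_side.[$r_u; $r_v]))
       PSkip).

Definition keep_component : prog :=
  PIf $r_flag (PSeq mark_solved copy_sides) PSkip.

Definition solve_component (cs : seq nat) : prog :=
  seqs [:: start_at_root cs; propagate; check_component; keep_component].

Definition color_sets (k : nat) : seq (seq nat) :=
  [seq [seq val c | c in cs] | cs : {set 'I_k}].

Definition solve_root (k : nat) : prog :=
  seqs [seq solve_component cs | cs <- color_sets k].

Definition solve_ends (k : nat) : prog :=
  PSeq (PFor r_u r_vertices (PWrite a_solved $r_u (Lit 0)))
       (PFor r_root r_vertices (solve_root k)).

Definition verify (k : nat) : prog :=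
  seqs [:: PAssign r_flag (Lit 1);
           search [:: r_u] (~~ (a_solved.[$r_u] && (a_color.[$r_u] < Lit k))) 0;
           search [:: r_u; r_v]
             (~~ ($r_u == $r_v) && (a_color.[$r_u] == a_color.[$r_v]) &&
              ~~ a_adj.[$r_u; $r_v]) 0].

(* The number [f] of a point stands for the end [odd f] of the edge [f %/ 2]. *)
Definition same_end_test (t : nat) : expr :=
  (Lit 2 * $r_u + Lit t == $r_v) ||
  linked $r_u ($r_v %/ Lit 2) &&
  (truth a_solution.[$r_u; $r_v %/ Lit 2] == Lit t) &&
  (Lit 2 * ($r_v %/ Lit 2) + truth a_solution.[$r_v %/ Lit 2; $r_u] == $r_v).

Definition write_points (a t : nat) : prog :=
  PFor r_u r_vertices
    (PSeq (find_last r_v r_points (same_end_test t)) (PWrite a $r_u $r_flag)).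

Definition write_root_graph : prog :=
  seqs [:: PFor r_u r_vertices (PWrite a_root_color $r_u a_color.[$r_u]);
           write_points a_root_tail 0; write_points a_root_head 1;
           PAssign r_root_edges $r_vertices; PAssign r_accept (Lit 1)].

Definition try_guess (k : nat) (g : seq nat) : prog :=
  PIf $r_accept PSkip
    (seqs [:: guess_colors k g; solve_ends k; verify k;
              PIf $r_flag write_root_graph PSkip]).

Definition color_strings (k : nat) : seq (seq nat) :=
  [seq [seq val c | c <- g] | g : (3 * k).-tuple 'I_k].

Definition recognize (k : nat) : prog :=
  PSeq read_graph (seqs [seq try_guess k g | g <- color_strings k]).

Lemma recognize_well_formed k : well_formed (recognize k).
Proof.
rewrite /recognize /= well_formed_seqs all_map; apply/allP=> g _ /=.
rewrite !well_formed_seqs !keeps_reg_seqs !all_map /=.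
by rewrite !andbT; apply/and3P; split; apply/allP.
Qed.

Lemma degree_recognize k : degree (recognize k) <= 5.
Proof.
rewrite /recognize /= geq_max /= degree_seqs all_map; apply/allP=> g _ /=.
rewrite !geq_max /= degree_seqs all_map /= -[5]/(1 + 4) leq_add2l.
rewrite degree_seqs !all_map.
by rewrite !andbT; apply/andP; split; apply/allP.
Qed.

(** * Correctness *)

Section Memory.
Variable n : nat.
Implicit Types (i j u v w : 'I_n) (s : state).

Definition entry s (a : nat) i j : bool := arr s a (i * n + j) != 0.

Lemma eq_cell i j i' j' : (i * n + j == i' * n + j') = (i == i') && (j == j').
Proof.
apply/eqP/andP => [/(congr1 (edivn^~ n))|[/eqP-> /eqP->]] //.
by rewrite !edivn_eq // => -[/val_inj-> /val_inj->]; rewrite !eqxx.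
Qed.

Lemma test_entry s a e1 e2 i j : reg s r_vertices = n ->
  eval s e1 = i -> eval s e2 = j -> test s a.[e1; e2] = entry s a i j.
Proof. by rewrite /test /= => -> -> ->. Qed.

Lemma run_for_row r a p w (value : 'I_n -> nat) s :
  reg s r_vertices = n -> keeps_reg r p ->
  (forall i s', frame (PFor r r_vertices p) s s' -> reg s' r = i ->
     (forall v u, v != w -> entry s' a v u = entry s a v u) ->
     forall m, arr (run p s') a m = if m == w * n + i then value i else arr s' a m) ->
  forall v u, entry (run (PFor r r_vertices p) s) a v u =
    if v == w then value u != 0 else entry s a v u.
Proof.
move=> sn keep body v u.
have cell_inj : injective (fun i : 'I_n => w * n + i) by move=> i j /addnI/val_inj.
have [|written rest] := run_for_cells (a := a) (value := value) sn keep cell_inj.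
  move=> i s' fr si rest; apply: body => // v' u' vw.
  by rewrite /entry rest // => i' _; rewrite eq_cell (negbTE vw).
rewrite /entry; case: (eqVneq v w) => [->|vw]; first by rewrite written.
by rewrite rest // => i; rewrite eq_cell (negbTE vw).
Qed.

End Memory.

Section GuessSpec.
Variables (n k : nat) (A : rel 'I_n).
Implicit Types (u v w : 'I_n) (s : state).

Definition stores_graph s : Prop :=
  [/\ reg s r_vertices = n, reg s r_points = n + n &
      forall u v, entry s a_adj u v = A u v].

Lemma stores_graph_frame p s s' :
  keeps_reg r_vertices p -> keeps_reg r_points p -> keeps_arr a_adj p ->
  frame p s s' -> stores_graph s -> stores_graph s'.
Proof.
move=> keep_n keep_points keep_adj [fr_reg fr_arr] [sn s_points adjE].
by split=> [||u v]; rewrite ?fr_reg // /entry fr_arr // -adjE.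
Qed.

Definition coloring s : {ffun 'I_n -> nat} := [ffun v : 'I_n => arr s a_color v].

Lemma coloring_color_last s c : stores_graph s ->
  coloring (run (color_last_vertex k c) s) = color_last k (coloring s) c.
Proof.
case=> sn _ _; rewrite /color_last_vertex run_seq; set s1 := run _ s.
have s1_arr a i : arr s1 a i = arr s a i by rewrite arr_run.
have s1_flag : reg s1 r_flag = \max_(v | coloring s v == k) val v.
  apply: reg_find_last => // i s' [_ fr_arr] iu.
  by rewrite test_eq /= iu fr_arr // ffunE.
apply/ffunP => u; rewrite !ffunE -s1_flag run_if test_eq /= s1_arr.
case: ifP => [uncolored|/negP colored].
  rewrite run_write /= s1_arr [u == _ :> nat]eq_sym.
  by have [<-|] := eqVneq (reg s1 r_flag) u; rewrite ?uncolored // andbF.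
rewrite run_skip s1_arr; case: ifP => // /andP[uk /eqP flag_u].
by case: colored; rewrite flag_u.
Qed.

Lemma satisfiable_crowded s c u : stores_graph s -> reg s r_u = u ->
  satisfiable n [:: r_v; r_w; r_x] (crowded_test c) s = crowded A (coloring s) c u.
Proof.
case=> sn _ adjE su.
pose nbr v := A u v && (coloring s v == c).
suff testE v w (x : 'I_n) :
    test (set_reg (set_reg (set_reg s r_v v) r_w w) r_x x) (crowded_test c) =
  [&& nbr v && nbr w && nbr x & [&& v != w, w != x & x != v]].
  apply/existsP/card_gt2P => [[v /existsP[w /existsP[x]]]|[v [w [x]]]].
    rewrite testE => /and4P[/andP[/andP[nv nw] nx] vw wx xv].
    by exists v, w, x; rewrite !inE.
  rewrite !inE => -[[nv nw nx] [vw wx xv]].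
  exists v; apply/existsP; exists w; apply/existsP; exists x.
  by rewrite testE /nbr nv nw nx vw wx xv.
set s' := set_reg _ _ _.
have nbrE r (i : 'I_n) : reg s' r = i ->
    test s' (a_adj.[$r_u; $r] && (a_color.[$r] == Lit c)) = nbr i.
  move=> ri; rewrite test_and test_eq (@test_entry n s' a_adj $r_u $r u i) //.
  by rewrite -[entry s' _ _ _]/(entry s _ _ _) adjE /nbr ffunE -ri.
rewrite /crowded_test test_and test_and test_and.
rewrite (nbrE r_v v) // (nbrE r_w w) // (nbrE r_x x) //.
by rewrite !test_and !test_not !test_eq -!andbA.
Qed.

Lemma arr_mark_crowded s c u : stores_graph s ->
  arr (run (mark_crowded c) s) a_crowded u = crowded A (coloring s) c u.
Proof.
move=> hs; have [sn _ _] := hs.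
apply: (arr_for_cells (value := crowded A (coloring s) c) sn) => //.
move=> i s' fr iu _ j; rewrite !run_seqsE run_write.
have hs' : stores_graph s' by apply: stores_graph_frame fr hs.
have [s'n _ _] := hs'.
have -> : coloring s = coloring s' by apply/ffunP => v; rewrite !ffunE fr.2.
set s1 := run (PAssign _ _) s'; have hs1 : stores_graph s1 by [].
have sat : satisfiable n [:: r_v; r_w; r_x] (crowded_test c) s1 =
    crowded A (coloring s') c i.
  by rewrite (@satisfiable_crowded s1 c i).
have flag : reg (run (search [:: r_v; r_w; r_x] (crowded_test c) 1) s1) r_flag =
    crowded A (coloring s') c i.
  by rewrite (@reg_search n) // sat; case: crowded.
rewrite /= flag arr_run ?keeps_arr_search //.
by rewrite reg_run // /= iu.
Qed.

Lemma coloring_absorb s c : stores_graph s ->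
  (forall u, arr s a_crowded u = crowded A (coloring s) c u) ->
  coloring (run (absorb_crowded k c) s) = absorb k A (coloring s) c.
Proof.
case=> sn _ _ crowdE; apply/ffunP => u; rewrite ffunE.
apply: (arr_for_cells (value := absorb k A (coloring s) c) sn) => //.
move=> i s' [_ fr_arr] iu unset j; rewrite run_if test_and test_eq /= iu unset.
rewrite /test /= iu fr_arr // crowdE ffunE eqb0 negbK !ffunE.
by case: ifP => _; rewrite runE /= ?iu //; case: eqP => // ->.
Qed.

Lemma coloring_guess_color s c : stores_graph s ->
  coloring (run (guess_color k c) s) = color_next k A (coloring s) c.
Proof.
move=> hs; rewrite !run_seqsE; set s1 := run _ s; set s2 := run _ s1.
have hs1 : stores_graph s1 by apply: stores_graph_frame (frame_run _ _) hs.
have hs2 : stores_graph s2 by apply: stores_graph_frame (frame_run _ _) hs1.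
have col2 : coloring s2 = coloring s1 by apply/ffunP => v; rewrite !ffunE arr_run.
rewrite coloring_absorb // ?col2 => [|u]; last exact: arr_mark_crowded.
by rewrite coloring_color_last.
Qed.

Lemma keeps_guess_colors g : [/\ keeps_reg r_vertices (guess_colors k g),
  keeps_reg r_accept (guess_colors k g), keeps_reg r_points (guess_colors k g) &
  keeps_arr a_adj (guess_colors k g)].
Proof. by split; rewrite /= ?keeps_reg_seqs ?keeps_arr_seqs all_map; apply/allP. Qed.

Lemma coloring_guess_colors g s : stores_graph s ->
  coloring (run (guess_colors k g) s) = color_all k A g.
Proof.
move=> hs; rewrite run_seq /color_all; set s1 := run _ s.
have hs1 : stores_graph s1 by apply: stores_graph_frame (frame_run _ _) hs.
have -> : [ffun=> k] = coloring s1.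
  have [sn _ _] := hs.
  apply/ffunP => v; rewrite !ffunE; apply/esym.
  apply: (arr_for_cells (value := fun=> k) sn) => // i s' _ iu _ j.
  by rewrite run_write /= iu.
elim: g s1 hs1 {hs} => // c g IH s1 hs1; rewrite /= run_seq IH.
  by rewrite coloring_guess_color.
exact: stores_graph_frame (frame_run _ _) hs1.
Qed.

End GuessSpec.

Section EndsSpec.
Variables (n k : nat) (A : rel 'I_n) (col : {ffun 'I_n -> nat}).
Hypothesis A_sym : symmetric A.
Implicit Types (u v w r : 'I_n) (s : state) (x : 'I_n -> 'I_n -> bool).

Local Notation linkA := (link A col).

Local Notation root_sideA := (root_side A col).

Let linkA_sym : symmetric linkA := link_sym col A_sym.

Definition stores s : Prop := stores_graph A s /\ coloring n s = col.

Lemma stores_frame p s s' :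
  keeps_reg r_vertices p -> keeps_reg r_points p -> keeps_arr a_adj p ->
  keeps_arr a_color p -> frame p s s' -> stores s -> stores s'.
Proof.
move=> keep_n keep_points keep_adj keep_color fr [hs colE]; split;
  first exact: stores_graph_frame fr hs.
by rewrite -colE; apply/ffunP => v; rewrite !ffunE fr.2.
Qed.

Lemma stores_run p s :
  keeps_reg r_vertices p -> keeps_reg r_points p -> keeps_arr a_adj p ->
  keeps_arr a_color p -> stores s -> stores (run p s).
Proof. by move=> *; apply: stores_frame (frame_run p s) _. Qed.

Lemma reg_vertices s : stores s -> reg s r_vertices = n. Proof. by case=> -[]. Qed.

Lemma arr_color s v : stores s -> arr s a_color v = col v.
Proof. by case=> _ colE; rewrite -colE ffunE. Qed.

Lemma test_linked s e1 e2 u v : stores s -> eval s e1 = u -> eval s e2 = v ->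
  test s (linked e1 e2) = linkA u v.
Proof.
move=> hs e1u e2v; have [[sn _ adjE] _] := hs.
rewrite test_and test_not test_eq (test_entry _ sn e1u e2v) adjE /=.
by rewrite e1u e2v !arr_color.
Qed.

Definition reached s : {set 'I_n} := [set v : 'I_n | arr s a_reached v != 0].

Lemma test_reached s e v : eval s e = v -> test s a_reached.[e] = (v \in reached s).
Proof. by move=> ev; rewrite inE /test /= ev. Qed.

Lemma reached_frame p s s' : keeps_arr a_reached p -> frame p s s' ->
  reached s' = reached s.
Proof. by move=> keep [_ fr]; apply/setP => v; rewrite !inE fr. Qed.

Definition side s u v : bool := entry s a_side u v.

Lemma entry_frame a p s s' u v : keeps_arr a p -> frame p s s' ->
  entry s' a u v = entry s a u v.
Proof. by move=> keep [_ fr]; rewrite /entry fr. Qed.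

Lemma reached_start cs s r : stores s -> reg s r_root = r ->
  reached (run (start_at_root cs) s) = [set r].
Proof.
move=> hs sr; rewrite run_seq (reached_frame _ (frame_run _ _)) //.
apply/setP => v; rewrite !inE.
rewrite (arr_for_cells (value := fun v => v == r :> nat) (reg_vertices hs)) //.
  by rewrite eqb0 negbK.
by move=> i s' [fr_reg _] si _ j; rewrite run_write /= si fr_reg // sr.
Qed.

Lemma side_start cs s r u : stores s -> reg s r_root = r ->
  side (run (start_at_root cs) s) r u = root_sideA cs r u.
Proof.
move=> hs sr; rewrite run_seq; set s1 := run _ s.
have hs1 : stores s1 by apply: stores_run.
have s1r : reg s1 r_root = r by rewrite reg_run.
rewrite /side (run_for_row (w := r) (value := root_sideA cs r) (reg_vertices hs1)) //.
  by rewrite eqxx; case: root_side.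
move=> i s' fr si _ m; rewrite !run_seqsE run_write.
set s2 := run (PAssign _ _) s'; set e := (_ && _)%E; set s3 := run _ s2.
have hs2 : stores s2 by apply: stores_run => //; apply: stores_frame fr hs1.
have s2r : reg s2 r_root = r by rewrite /s2 runE /= fr.1.
have flag : reg s3 r_flag = [exists w : 'I_n, [&& w < i, linkA r w & col w == col i]].
  rewrite (reg_search (n := n)) ?reg_vertices //= [X in if X then _ else _](_ : _ =
    [exists w : 'I_n, [&& w < i, linkA r w & col w == col i]]).
    by case: existsP.
  apply: eq_existsb => w; rewrite test_and test_and test_lt test_eq -andbA.
  rewrite (test_linked (u := r) (v := w)) //.
  by rewrite /= si !arr_color.
have hs3 : stores s3 by apply: stores_run.
have [s3r s3i] : reg s3 r_root = r /\ reg s3 r_u = i by rewrite !reg_run.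
have sideE : eval s3 (~~ $r_flag == truth (one_of cs a_color.[$r_u]))%E =
    root_sideA cs r i.
  rewrite eval_eq eval_not eval_truth test_one_of /test /= s3i arr_color // flag.
  by rewrite /root_side; case: existsP; case: (_ \in _).
by rewrite sideE /= s3r s3i reg_vertices // !arr_run.
Qed.

Definition propagates s s' : Prop :=
  [/\ reached s \subset reached s',
      closed linkA (reached s) -> reached s' = reached s &
      forall x, consistent linkA x ->
        {in reached s, forall v, agree_at linkA x (side s) v} ->
        {in reached s', forall v, agree_at linkA x (side s') v}].

Lemma propagates_refl s : propagates s s. Proof. by split. Qed.

Lemma propagates_trans s1 s2 s3 :
  propagates s1 s2 -> propagates s2 s3 -> propagates s1 s3.
Proof.
move=> [sub12 closed12 agree12] [sub23 closed23 agree23]; split.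
- exact: subset_trans sub23.
- by move=> cl; have same := closed12 cl; rewrite closed23 same.
- by move=> x cx /(agree12 x cx)/(agree23 x cx).
Qed.

Lemma side_propagate_row s v w :
  stores s -> reg s r_v = v -> reg s r_w = w -> v != w ->
  forall u' u, side (run propagate_row s) u' u =
    if u' == v then ~~ ((u == w) || linkA w u && (side s w u == side s w v))
    else side s u' u.
Proof.
move=> hs sv sw vw u' u.
pose value u := ~~ ((u == w) || linkA w u && (side s w u == side s w v)).
rewrite /side (run_for_row (w := v) (value := value) (reg_vertices hs)) //.
  by case: ifP => // _; rewrite eqb0 negbK.
move=> i s' fr si rest m; rewrite run_write.
have hs' : stores s' by apply: stores_frame fr hs.
have s'n := reg_vertices hs'; have s'v : reg s' r_v = v by rewrite fr.1.
have s'w : reg s' r_w = w by rewrite fr.1.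
rewrite eval_not test_or test_and !test_eq !eval_truth.
rewrite (@test_linked s' $r_w $r_x w i) //.
rewrite (@test_entry n s' a_side $r_w $r_x w i) //
  (@test_entry n s' a_side $r_w $r_v w v) //.
rewrite !rest ?[w == v]eq_sym //.
rewrite /= s'v s'n si s'w /value /side;
  congr (if _ then nat_of_bool (~~ (_ || _ && _)) else _).
by case: (entry s _ w i); case: (entry s _ w v).
Qed.

Lemma propagate_edge_spec s v w : stores s -> reg s r_v = v -> reg s r_w = w ->
  propagates s (run propagate_edge s) /\
  (w \in reached s -> linkA v w -> v \in reached (run propagate_edge s)).
Proof.
move=> hs sv sw; rewrite run_if test_and test_and test_not
  (@test_linked s $r_v $r_w v w) //.
rewrite (test_reached (v := v)) // (test_reached (v := w)) // -andbA.
case: ifP => [/and3P[v_new w_old vw]|old]; last first.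
  split; first exact: propagates_refl.
  by move=> w_old vw; move: old; rewrite w_old vw run_skip; case: (v \in _).
have v_neq_w : v != w by apply: contraNneq v_new => ->.
rewrite run_seq; set s1 := run _ s; set s2 := run _ s1.
have hs1 : stores s1 by apply: stores_run.
have reached2 : reached s2 = v |: reached s.
  apply/setP => u; rewrite !inE arr_run // /s1 run_write /= sv -val_eqE.
  by case: (val u == val v).
have side2 := side_propagate_row hs1 sv sw v_neq_w.
split; last by rewrite reached2 setU11.
split=> [|cl|x cx agree u]; rewrite ?reached2 ?subsetUr //.
  by case/negP: v_new; rewrite (cl v w).
have [-> _|uv] := eqVneq u v.
  apply: (@agree_at_neighbor _ _ linkA_sym x _ v w cx vw); last first.
    by move=> u'; rewrite !side2 eqxx [w == v]eq_sym (negbTE v_neq_w).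
  have [b sidew] := agree w w_old; exists b => u' wu'.
  by rewrite side2 eq_sym (negbTE v_neq_w) -sidew.
rewrite in_setU1 (negbTE uv) => /agree[b sideu]; exists b => u' uu'.
by rewrite side2 (negbTE uv) -sideu.
Qed.

Lemma propagate_vertex_spec s v : stores s -> reg s r_v = v ->
  propagates s (run propagate_vertex s) /\
  (forall w, w \in reached s -> linkA v w -> v \in reached (run propagate_vertex s)).
Proof.
move=> hs sv; have sn := reg_vertices hs.
pose I m s' := propagates s s' /\
  forall w, w < m -> w \in reached s -> linkA v w -> v \in reached s'.
suff [prop new] : I n (run propagate_vertex s) by split=> // w; apply: new.
rewrite -[n in I n]sn; apply: run_for => // m s1.
rewrite sn => mn fr s1w [prop1 new1].
have hs1 : stores s1 by apply: stores_frame fr hs.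
have s1v : reg s1 r_v = v by rewrite fr.1.
have [prop2 new2] := propagate_edge_spec hs1 s1v (w := Ordinal mn) s1w.
have [[sub1 _ _] [sub2 _ _]] := (prop1, prop2).
split=> [|w]; first exact: propagates_trans prop2.
rewrite ltnS leq_eqVlt => /predU1P[wm|wm] w_old vw; last first.
  by apply: (subsetP sub2); apply: new1 vw.
have wE : w = Ordinal mn by apply: val_inj.
by rewrite wE in w_old vw; apply: new2 vw; apply: (subsetP sub1).
Qed.

Lemma propagate_round_spec s : stores s ->
  propagates s (run propagate_round s) /\
  (forall v w, w \in reached s -> linkA v w -> v \in reached (run propagate_round s)).
Proof.
move=> hs; have sn := reg_vertices hs.
pose I m s' := propagates s s' /\
  forall v w, v < m -> w \in reached s -> linkA v w -> v \in reached s'.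
suff [prop new] : I n (run propagate_round s) by split=> // v w; apply: new.
rewrite -[n in I n]sn; apply: run_for => // m s1.
rewrite sn => mn fr s1v [prop1 new1].
have hs1 : stores s1 by apply: stores_frame fr hs.
have [prop2 new2] := propagate_vertex_spec hs1 (v := Ordinal mn) s1v.
have [[sub1 _ _] [sub2 _ _]] := (prop1, prop2).
split=> [|v w]; first exact: propagates_trans prop2.
rewrite ltnS leq_eqVlt => /predU1P[vm|vm] w_old vw; last first.
  by apply: (subsetP sub2); apply: new1 vw.
have vE : v = Ordinal mn by apply: val_inj.
by rewrite vE in vw *; apply: new2 vw; apply: (subsetP sub1).
Qed.

Lemma propagate_spec s r : stores s -> r \in reached s ->
  let s' := run propagate s in
  [/\ closed linkA (reached s'), r \in reached s' &
      forall x, consistent linkA x ->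
        {in reached s, forall v, agree_at linkA x (side s) v} ->
        {in reached s', forall v, agree_at linkA x (side s') v}].
Proof.
move=> hs r_old; have sn := reg_vertices hs.
pose I m s' := propagates s s' /\ (closed linkA (reached s') \/ m < #|reached s'|).
suff [[sub _ agree] many] : I n (run propagate s).
  split=> //; last exact: (subsetP sub).
  case: many => // /leq_trans/(_ (max_card _)); by rewrite card_ord ltnn.
rewrite -[n in I n]sn; apply: run_for => //.
  by split; [exact: propagates_refl | right; apply/card_gt0P; exists r].
move=> m s1 _ fr _ [prop1 many1]; have hs1 : stores s1 by apply: stores_frame fr hs.
have [prop12 new] := propagate_round_spec hs1; have [sub12 closed12 _] := prop12.
split; first exact: propagates_trans prop12.
have [same|more] := eqVneq (reached (run propagate_round s1)) (reached s1).
  left; rewrite same; apply: (intro_closed (sym_connect_sym linkA_sym)) => w v.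
  by rewrite linkA_sym -{2}same => vw w_old; apply: new vw.
case: many1 => [/closed12 same|many1]; first by rewrite same eqxx in more.
by right; apply: leq_ltn_trans many1 (proper_card _); rewrite properEneq eq_sym more.
Qed.

Definition inconsistency s v u w : bool :=
  [&& v \in reached s, u != w, linkA v u, linkA v w &
      (side s v u == side s v w) != linkA u w && (side s u v == side s u w)].

Lemma test_inconsistent s u v w :
  stores s -> reg s r_u = v -> reg s r_v = u -> reg s r_w = w ->
  test s inconsistent_test = inconsistency s v u w.
Proof.
move=> hs sv su sw; have sn := reg_vertices hs.
have sideE (r1 r2 : nat) (a b : 'I_n) : reg s r1 = a -> reg s r2 = b ->
    test s a_side.[$r1; $r2] = side s a b by apply: (@test_entry n s a_side $r1 $r2).
rewrite /inconsistent_test test_and test_and test_and test_and test_not test_eq.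
rewrite (test_reached (v := v)) // (@test_linked s $r_u $r_v v u) //.
rewrite (@test_linked s $r_u $r_w v w) // test_eq eval_eq eval_not test_and test_eq.
rewrite !eval_truth (@test_linked s $r_v $r_w u w) // (sideE r_u r_v v u) //.
rewrite (sideE r_u r_w v w) // (sideE r_v r_u u v) // (sideE r_v r_w u w) //.
rewrite /= su sw -andbA -andbA -andbA; congr [&& _, _, _, _ & _].
by case: (linkA u w); do 2!case: (side s v _); do 2!case: (side s u _).
Qed.

Lemma check_component_spec s : stores s ->
  reg (run check_component s) r_flag != 0 <->
  {in reached s, forall v, consistent_at linkA (side s) v}.
Proof.
move=> hs; rewrite run_seq; set s1 := run (PAssign _ _) s.
have hs1 : stores s1 by apply: stores_run.
rewrite (reg_search (n := n)) ?reg_vertices // [reg s1 r_flag]/=;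
  set sat := satisfiable _ _ _ _.
have testE v u w :
    test (set_reg (set_reg (set_reg s1 r_u v) r_v u) r_w w) inconsistent_test =
    inconsistency s v u w by apply: test_inconsistent.
have satP : reflect (exists v u w, inconsistency s v u w) sat.
  apply: (iffP existsP) => [[v /existsP[u /existsP[w sat_vuw]]]|[v [u [w bad_vuw]]]].
    by exists v, u, w; rewrite -testE.
  by exists v; apply/existsP; exists u; apply/existsP; exists w; rewrite /= testE.
case: satP => [[v [u [w /and5P[v_in uw vu vw differ]]]]|ok]; split=> //.
  by move=> /(_ v v_in u w uw vu vw) same; rewrite same eqxx in differ.
move=> _ v v_in u w uw vu vw; case: (eqVneq (side s v u == side s v w)
  (linkA u w && (side s u v == side s u w))) => // differ; case: ok; exists v, u, w.
by rewrite /inconsistency v_in uw vu vw differ.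
Qed.

Definition solved s : {set 'I_n} := [set v : 'I_n | arr s a_solved v != 0].

Definition solution s u v : bool := entry s a_solution u v.

Lemma solved_mark_solved s : stores s ->
  solved (run mark_solved s) = reached s :|: solved s.
Proof.
move=> hs; apply/setP => v; rewrite !inE.
rewrite (arr_for_cells
  (value := fun v => if v \in reached s then 1 else arr s a_solved v)
  (reg_vertices hs)) //; first by rewrite inE; case: (arr s a_reached v).
move=> i s' fr si same j; rewrite run_if (test_reached (v := i)) //.
rewrite (reached_frame _ fr) //; case: ifP => _; rewrite runE /= ?si //.
by case: eqP => // ->.
Qed.

Lemma solution_copy_sides s : stores s -> forall v u,
  solution (run copy_sides s) v u =
    if v \in reached s then side s v u else solution s v u.
Proof.
move=> hs; have sn := reg_vertices hs.
pose I m s' := forall v u, solution s' v u =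
  if (v < m) && (v \in reached s) then side s v u else solution s v u.
suff copied : I n (run copy_sides s) by move=> v u; rewrite copied ltn_ord.
rewrite -[n in I n]sn; apply: run_for => // m s1.
rewrite sn => mn fr s1m copied v u.
have vm : (v < m.+1) = (v == Ordinal mn) || (v < m) by rewrite ltnS leq_eqVlt.
rewrite run_if (test_reached (v := Ordinal mn)) // (reached_frame _ fr) //.
case: ifP => [m_in|m_out]; last first.
  by rewrite run_skip copied vm; case: eqP => [->|] //; rewrite m_out !andbF.
have hs1 : stores s1 by apply: stores_frame fr hs.
rewrite /solution (run_for_row (w := Ordinal mn)
  (value := fun u => arr s1 a_side (m * n + u)) (reg_vertices hs1)) // =>
    [|i s2 fr2 si _ j].
  rewrite -/(solution s1 v u) copied vm; case: eqP => [->|//] /=.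
  by rewrite m_in /side /entry fr.2.
have s2m : reg s2 r_u = m by rewrite fr2.1.
by rewrite run_write /= s2m si fr2.1 // (reg_vertices hs1) fr2.2.
Qed.

Lemma keep_component_spec s : stores s -> let s' := run keep_component s in
  if reg s r_flag != 0 then
    solved s' = reached s :|: solved s /\
    forall v u, solution s' v u =
      if v \in reached s then side s v u else solution s v u
  else s' = s.
Proof.
move=> hs; rewrite run_if /test /=; case: (reg s r_flag != 0) => //; rewrite run_seq.
set s1 := run _ s; have hs1 : stores s1 by apply: stores_run.
split=> [|v u].
  by rewrite -(solved_mark_solved hs); apply/setP => v; rewrite !inE arr_run.
have -> : reached s = reached s1 by apply/esym/reached_frame/frame_run.
have -> : side s v u = side s1 v u by apply/esym/entry_frame/frame_run.
have -> : solution s v u = solution s1 v u by apply/esym/entry_frame/frame_run.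
exact: solution_copy_sides.
Qed.

Definition sound s : Prop :=
  closed linkA (solved s) /\
  {in solved s, forall v, consistent_at linkA (solution s) v}.

Lemma eq_sound s s' : solved s' = solved s ->
  (forall v u, solution s' v u = solution s v u) ->
  sound s -> sound s'.
Proof.
rewrite /sound => -> same [cl cons]; split=> // v /cons.
by apply: eq_consistent_at => [u|w _ u]; rewrite same.
Qed.

Lemma propagate_from_root cs s r : stores s -> reg s r_root = r ->
  let s' := run propagate (run (start_at_root cs) s) in
  [/\ closed linkA (reached s'), r \in reached s' &
      forall x, consistent linkA x ->
        (forall u, linkA r u -> root_sideA cs r u = x r u) ->
        {in reached s', forall v, consistent_at linkA (side s') v}].
Proof.
move=> hs sr; set s1 := run _ s.
have hs1 : stores s1 by apply: stores_run.
have reached1 : reached s1 = [set r] := reached_start cs hs sr.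
have r_in : r \in reached s1 by rewrite reached1 set11.
have [cl r_in' agree] := propagate_spec hs1 r_in.
split=> // x cx root_x v v_in.
have agree1 : {in reached s1, forall v, agree_at linkA x (side s1) v}.
  move=> _ /[!(reached1, inE)] /eqP->; exists false => u link_u.
  by rewrite (side_start _ _ hs sr) root_x // addbF.
have agree' := agree x cx agree1.
apply: consistent_at_agree cx (agree' v v_in) _ => // u vu.
by apply: agree'; rewrite -(cl v u vu).
Qed.

Lemma solve_component_spec cs s r : stores s -> reg s r_root = r -> sound s ->
  let s' := run (solve_component cs) s in
  [/\ sound s', solved s \subset solved s' &
      forall x, consistent linkA x ->
        (forall u, linkA r u -> root_sideA cs r u = x r u) ->
        r \in solved s'].
Proof.
move=> hs sr sound_s; rewrite !run_seqsE.
have [cl r_in ends] := propagate_from_root cs hs sr; move: cl r_in ends.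
set s2 := run propagate _; set s3 := run check_component s2 => cl r_in ends.
have fr2 : frame (PSeq (start_at_root cs) propagate) s s2 by apply: frame_run.
have hs2 : stores s2 by apply: stores_frame fr2 hs.
have hs3 : stores s3 by apply: stores_run.
have checked := check_component_spec hs2; rewrite -/s3 in checked.
have := keep_component_spec hs3; set s4 := run _ s3; rewrite /=.
have solved3 : solved s3 = solved s by apply/setP => v; rewrite !inE !arr_run.
have solution3 v u : solution s3 v u = solution s v u.
  by rewrite /solution /entry !arr_run.
have reached3 : reached s3 = reached s2 by apply: reached_frame (frame_run _ _).
have side3 v u : side s3 v u = side s2 v u by apply: entry_frame (frame_run _ _).
case: ifP => [/checked consistent2 [solved4 solution4]|failed ->].
  rewrite solved3 reached3 in solved4; split.
  - split; first by rewrite solved4 => v w vw;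
      rewrite !in_setU (cl v w vw) (sound_s.1 v w vw).
    move=> v; rewrite solved4.
    move=> /(consistent_merge cl sound_s.1 sound_s.2 consistent2).
    by apply: eq_consistent_at => [u|w _ u];
      rewrite solution4 reached3 side3 solution3.
  - by rewrite solved4 subsetUr.
  - by move=> *; rewrite solved4 inE r_in.
split; [exact: eq_sound sound_s | by rewrite solved3 |].
by move=> x cx /(ends x cx)/checked; rewrite failed.
Qed.

Lemma keeps_reg_solve_components (r : nat) css :
  r \in [:: r_vertices; r_accept; r_points; r_root] ->
  keeps_reg r (seqs [seq solve_component cs | cs <- css]).
Proof.
by rewrite keeps_reg_seqs all_map !inE => /or4P[] /eqP->; apply/allP.
Qed.

Lemma keeps_arr_solve_components a css : a \in [:: a_adj; a_color] ->
  keeps_arr a (seqs [seq solve_component cs | cs <- css]).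
Proof. by rewrite keeps_arr_seqs all_map !inE => /orP[] /eqP->; apply/allP. Qed.

Lemma solve_components_spec css s r : stores s -> reg s r_root = r -> sound s ->
  let s' := run (seqs [seq solve_component cs | cs <- css]) s in
  [/\ sound s', solved s \subset solved s' &
      forall x cs, cs \in css -> consistent linkA x ->
        (forall u, linkA r u -> root_sideA cs r u = x r u) -> r \in solved s'].
Proof.
elim: css s => [|cs css IH] s hs sr sound_s; first by [].
rewrite map_cons run_seqs_cons; set s1 := run (solve_component cs) s.
have hs1 : stores s1 by apply: stores_run.
have [sound1 sub1 root1] := solve_component_spec cs hs sr sound_s.
have s1r : reg s1 r_root = r by rewrite reg_run.
have [sound2 sub2 root2] := IH s1 hs1 s1r sound1; split=> //.
  exact: subset_trans sub2.
move=> x cs' /predU1P[->|cs'_in] cx root_x; last exact: root2 root_x.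
by apply: (subsetP sub2); apply: root1 root_x.
Qed.

Lemma solve_ends_spec s : stores s -> let s' := run (solve_ends k) s in
  sound s' /\
  ((forall v, col v < k) -> (exists x, consistent linkA x) -> solved s' = setT).
Proof.
move=> hs; rewrite run_seq; set s1 := run _ s.
have hs1 : stores s1 by apply: stores_run.
have solved1 : solved s1 = set0.
  apply/setP => v; rewrite !inE.
  rewrite (arr_for_cells (value := fun=> 0) (reg_vertices hs)) // => i s' _ si _ j.
  by rewrite run_write /= si.
pose all_below m s' := (forall v, col v < k) -> (exists x, consistent linkA x) ->
  forall v, v < m -> v \in solved s'.
pose I m s' := sound s' /\ all_below m s'.
suff [sound_s' all_solved] : I n (run (PFor r_root r_vertices (solve_root k)) s1).
  by split=> // col_lt ex; apply/setP => v; rewrite [RHS]inE all_solved.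
rewrite -[n in I n](reg_vertices hs1); apply: run_for => //.
- by rewrite keeps_reg_solve_components.
- by split=> //; split=> [v w _|v]; rewrite solved1 !inE.
move=> m s2; rewrite (reg_vertices hs1) => mn fr s2m [sound2 below].
have hs2 : stores s2 by apply: stores_frame fr hs1;
  rewrite /= ?keeps_reg_solve_components ?keeps_arr_solve_components.
have [sound3 sub root] :=
  @solve_components_spec (color_sets k) s2 (Ordinal mn) hs2 s2m sound2.
split=> // col_lt [x cx] v; rewrite ltnS leq_eqVlt => /predU1P[vm|vm]; last first.
  by apply: (subsetP sub); apply: below => //; exists x.
have -> : v = Ordinal mn by apply: val_inj.
have [cs root_cs] := root_side_complete (Ordinal mn) col_lt cx.
by apply: root cx root_cs; apply: codom_f.
Qed.

End EndsSpec.

(** ** Points of the root graph *)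

Section Points.
Variables (n : nat) (A : rel 'I_n) (col : {ffun 'I_n -> nat}).
Hypothesis A_sym : symmetric A.
Implicit Types (v : 'I_n) (f : 'I_(n + n)) (p q : 'I_n * bool).

Local Notation same_endA := (same_end (link A col)).

Lemma end_number_lt p : 2 * p.1 + p.2 < n + n.
Proof. by case: p => v [] /=; have := ltn_ord v; lia. Qed.

Definition end_number p : 'I_(n + n) := Ordinal (end_number_lt p).

Lemma half_lt f : f %/ 2 < n. Proof. by have := ltn_ord f; lia. Qed.

Definition end_of f : 'I_n * bool := (Ordinal (half_lt f), odd f).

Lemma eq_end_of p f : (p == end_of f) = (2 * p.1 + p.2 == f).
Proof. by case: p => v t; rewrite -pair_eqE /= -val_eqE /=; case: t; lia. Qed.

Lemma end_numberK p : end_of (end_number p) = p.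
Proof. by apply/esym/eqP; rewrite eq_end_of. Qed.

Definition point x p : 'I_(n + n) :=
  [arg max_(f > end_number p | same_endA x p (end_of f)) val f].

Lemma val_point x p : val (point x p) = \max_(f | same_endA x p (end_of f)) val f.
Proof. by rewrite (bigmax_eq_arg (end_number p)) // end_numberK same_end_refl. Qed.

Lemma same_end_point x p : same_endA x p (end_of (point x p)).
Proof.
by rewrite /point; case: arg_maxnP => //; rewrite end_numberK same_end_refl.
Qed.

Lemma eq_point x p q : consistent (link A col) x ->
  (point x p == point x q) = same_endA x p q.
Proof.
move=> cx; have sym := same_end_sym (link_sym col A_sym) x.
have trans := same_end_trans (link_sym col A_sym) cx.
apply/eqP/idP => [same|pq].
  by apply: trans (same_end_point x p) _; rewrite same sym same_end_point.
apply: val_inj; rewrite !val_point; apply: eq_bigl => f.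
by apply/idP/idP; apply: trans; rewrite // sym.
Qed.

End Points.

Section OutputSpec.
Variables (n k : nat) (A : rel 'I_n) (col : {ffun 'I_n -> nat}).
Implicit Types (u v : 'I_n) (s : state) (t : bool).

Local Notation linkA := (link A col).
Local Notation storesA := (stores A col).

Lemma test_same_end s v (f : 'I_(n + n)) t :
  storesA s -> reg s r_u = v -> reg s r_v = f ->
  test s (same_end_test t) = same_end linkA (solution s) (v, t) (end_of f).
Proof.
move=> hs sv sf; have sn := reg_vertices hs.
pose u := (end_of f).1; have sf2 : eval s ($r_v %/ Lit 2)%E = u by rewrite /= sf.
have linkE : test s (linked $r_u ($r_v %/ Lit 2)) = linkA v u.
  exact: (test_linked hs (e1 := $r_u) sv sf2).
have sol_vu : test s a_solution.[$r_u; $r_v %/ Lit 2] = solution s v u.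
  exact: (test_entry a_solution sn (e1 := $r_u) sv sf2).
have sol_uv : test s a_solution.[$r_v %/ Lit 2; $r_u] = solution s u v.
  exact: (test_entry a_solution sn (e2 := $r_u) sf2 sv).
have pointE : eval s (Lit 2 * ($r_v %/ Lit 2) +
    truth a_solution.[$r_v %/ Lit 2; $r_u])%E = 2 * u + solution s u v.
  by rewrite -sol_uv -eval_truth -sf2.
rewrite test_or test_eq test_and test_and !test_eq linkE pointE eval_truth sol_vu.
rewrite [eval s (_ + _)%E]/= [eval s $r_v]/= sv sf [eval s (Lit t)]/=.
have odd_f (b : bool) : (2 * u + b == f) = (b == odd f).
  by rewrite -(eq_end_of (u, b)) /end_of -pair_eqE /= eqxx.
rewrite odd_f -(eq_end_of (v, t)) -andbA /same_end; congr (_ || _ && (_ && _)).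
by case: (t); case: (solution s v u).
Qed.

Lemma stores_write_points a t s s' : a \in [:: a_root_tail; a_root_head] ->
  frame (write_points a t) s s' -> storesA s -> storesA s'.
Proof. by rewrite !inE => /orP[]/eqP->; apply: stores_frame. Qed.

Lemma keeps_solution_write_points a t : a \in [:: a_root_tail; a_root_head] ->
  keeps_arr a_solution (write_points a t).
Proof. by rewrite !inE => /orP[]/eqP->. Qed.

Lemma arr_write_points a s v t : a \in [:: a_root_tail; a_root_head] -> storesA s ->
  arr (run (write_points a t) s) a v = point A col (solution s) (v, t).
Proof.
move=> a_out hs; have sn := reg_vertices hs.
apply: (arr_for_cells (value := fun v => point A col (solution s) (v, t)) sn) => //.
move=> i s' fr si _ j; have hs' := stores_write_points a_out fr hs.
have [[_ s'_points _] _] := hs'; rewrite run_seq run_write.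
have -> : eval (run (find_last r_v r_points (same_end_test t)) s') $r_flag =
    point A col (solution s) (i, t).
  pose P f := same_end linkA (solution s) (i, t) (end_of f).
  rewrite val_point /= (reg_find_last (P := P)) //.
  move=> f s2 fr2 s2f; have hs2 : storesA s2 by apply: stores_frame fr2 hs'.
  rewrite (test_same_end t hs2 _ s2f (v := i)); last by rewrite fr2.1.
  rewrite /same_end /solution !(entry_frame _ _ _ fr2) // !(entry_frame _ _ _ fr) //.
    exact: keeps_solution_write_points.
  exact: keeps_solution_write_points.
by rewrite /= eqxx reg_run // si arr_run.
Qed.

Lemma write_root_graph_spec s : storesA s -> let s' := run write_root_graph s in
  [/\ reg s' r_accept = 1, reg s' r_root_edges = n,
      forall v, arr s' a_root_color v = col v,
      forall v, arr s' a_root_tail v = point A col (solution s) (v, false) &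
      forall v, arr s' a_root_head v = point A col (solution s) (v, true)].
Proof.
move=> hs; rewrite !run_seqsE; set s1 := run _ s; set s2 := run _ s1;
  set s3 := run _ s2.
have hs1 : storesA s1 by apply: stores_run.
have hs2 : storesA s2 by apply: stores_run.
have hs3 : storesA s3 by apply: stores_run.
have same_sol s' :
    (forall a i, a \notin [:: a_root_tail; a_root_head; a_root_color] ->
       arr s' a i = arr s a i) ->
    forall p, point A col (solution s') p = point A col (solution s) p.
  move=> same p; apply: val_inj; rewrite !val_point; apply: eq_bigl => f.
  by rewrite /same_end /solution /entry !same.
split=> // [|v|v|v]; rewrite !run_assign /=; first exact: reg_vertices hs3.
- rewrite /s3 arr_run // /s2 arr_run //.
  apply: (arr_for_cells (value := col) (reg_vertices hs)) => //.
  move=> i s' fr si _ j; have hs' : storesA s' by apply: stores_frame fr hs.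
  by rewrite run_write /= si (arr_color i hs').
- rewrite /s3 arr_run // (@arr_write_points a_root_tail s1 v false) //.
  rewrite same_sol // => a i.
  by rewrite /s1 !inE !negb_or => /and3P[_ _ not_color]; rewrite arr_run //= eq_sym.
- rewrite (@arr_write_points a_root_head s2 v true) // same_sol // => a i.
  rewrite !inE !negb_or => /and3P[not_tail not_head not_color].
  by rewrite /s2 arr_run /s1 ?arr_run //= eq_sym.
Qed.

Lemma verify_spec s : storesA s ->
  reg (run (verify k) s) r_flag != 0 <->
  [/\ solved n s = setT, forall v, col v < k &
      forall u v, u != v -> col u = col v -> A u v].
Proof.
move=> hs; rewrite !run_seqsE; set s1 := run _ s; set s2 := run _ s1.
have hs1 : storesA s1 by apply: stores_run.
have hs2 : storesA s2 by apply: stores_run.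
have s1n := reg_vertices hs1; have s2n := reg_vertices hs2.
pose unfinished := [exists v, ~~ ((v \in solved n s) && (col v < k))].
pose apart := [exists u, exists v, [&& u != v, col u == col v & ~~ A u v]].
have flag1 : reg s2 r_flag = ~~ unfinished.
  rewrite (@reg_search n _ _ _ s1 s1n) // [reg s1 r_flag]/=.
  rewrite [satisfiable _ _ _ _](_ : _ = unfinished); first by case: unfinished.
  apply: eq_existsb => v; rewrite [LHS]test_not test_and test_lt /= inE.
  by rewrite /test /= (arr_color _ hs).
rewrite (@reg_search n _ _ _ s2 s2n) // flag1.
rewrite [satisfiable _ _ _ _](_ : _ = apart); last first.
  apply: eq_existsb => u; apply: eq_existsb => v.
  rewrite [LHS]test_and test_and !test_not !test_eq -andbA /= !(arr_color _ hs2).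
  have [[_ _ adjE] _] := hs2.
  by rewrite (@test_entry n _ a_adj $r_u $r_v u v) // -adjE.
split=> [|[all_solved col_lt clique]].
  case: (boolP apart) => // /existsPn all_adj;
    case: (boolP unfinished) => // /existsPn.
  move=> finished _; have {}finished v : (v \in solved n s) && (col v < k).
    exact: negbNE (finished v).
  split=> [|v|u v uv same].
  - by apply/setP => v; rewrite [RHS]inE; case/andP: (finished v).
  - by case/andP: (finished v).
  - by have /existsPn/(_ v) := all_adj u; rewrite uv same eqxx negbK.
case: (boolP apart) => [/existsP[u /existsP[v /and3P[uv /eqP same]]]|_].
  by rewrite clique.
case: (boolP unfinished) => // /existsP[v].
by rewrite all_solved in_setT col_lt.
Qed.

End OutputSpec.

(** ** The whole algorithm *)

Lemma mkseq_enum_ord T (f : nat -> T) n :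
  mkseq f n = [seq f (val i) | i <- enum 'I_n].
Proof. by rewrite /mkseq -val_enum_ord -map_comp. Qed.

Section Recognition.
Variables (n k : nat) (A : rel 'I_n).
Hypotheses (A_sym : symmetric A) (A_irr : irreflexive A).
Implicit Types (u v : 'I_n) (s : state).

Local Notation graphA := (SGraph A_sym A_irr).

Definition solution_found s : Prop :=
  exists (H : sgraph) (phi : edge H -> 'I_k),
    [/\ proper_coloring phi, graph_iso graphA (CL phi) & outputs s phi].

Section RootOutput.
Variables (col : {ffun 'I_n -> nat}) (x : 'I_n -> 'I_n -> bool).
Hypothesis cert : certificate A k col x.

Lemma eq_ends (p q : graphA * bool) :
  (point A col x p == point A col x q) = same_end (link A col) x p q.
Proof. exact: (eq_point A_sym p q (ends_consistent cert)). Qed.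

Lemma root_outputs s : reg s r_points = n + n -> reg s r_root_edges = n ->
  (forall v, arr s a_root_color v = col v) ->
  (forall v, arr s a_root_tail v = point A col x (v, false)) ->
  (forall v, arr s a_root_head v = point A col x (v, true)) ->
  outputs s (root_color (G := graphA) cert (eq_point := eq_ends)).
Proof.
move=> points edges colors tail_points head_points.
have size_enum_n := size_enum_ord n.
exists (root_pairs eq_ends); split; first exact: root_pairs_edge_list.
- by rewrite points edges card_ord size_map size_enum_n.
- rewrite size_map size_enum_n !mkseq_enum_ord /tails /heads -!map_comp.
  by split; apply: eq_map => v /=; rewrite enum_rank_ord ?tail_points ?head_points.
move=> e i pair; rewrite onth_map; have [i_n|n_i] := ltnP i n; last first.
  by rewrite onth_default ?size_enum_n.
have -> : onth (enum 'I_n) i = Some (Ordinal i_n).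
  rewrite onthE (nth_map (Ordinal i_n)) ?size_enum_n //; congr Some.
  by apply: val_inj; rewrite /= nth_enum_ord.
move=> [<-] e_ends; have -> : e = root_edge eq_ends (Ordinal i_n) by apply: val_inj.
by rewrite /= root_edgeK (colors (Ordinal i_n)).
Qed.

Lemma solution_of_certificate s : reg s r_points = n + n -> reg s r_root_edges = n ->
  (forall v, arr s a_root_color v = col v) ->
  (forall v, arr s a_root_tail v = point A col x (v, false)) ->
  (forall v, arr s a_root_head v = point A col x (v, true)) -> solution_found s.
Proof.
move=> *; exists (root_graph eq_ends).
exists (root_color (G := graphA) cert (eq_point := eq_ends)).
split; [exact: root_color_proper | exact: root_graph_iso | exact: root_outputs].
Qed.

End RootOutput.

Lemma try_guess_spec g s : stores_graph A s ->
  (reg s r_accept != 0 -> solution_found s) ->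
  let s' := run (try_guess k g) s in
  [/\ stores_graph A s', reg s' r_accept != 0 -> solution_found s',
      reg s r_accept != 0 -> reg s' r_accept != 0 &
      forall x, certificate A k (color_all k A g) x -> reg s' r_accept != 0].
Proof.
move=> hs found; rewrite /try_guess run_if -[test s $r_accept]/(reg s r_accept != 0).
have [accept0|//] := eqVneq (reg s r_accept) 0;
  rewrite [~~ _]/= 4!run_seqs_cons run_seqs_nil.
set col := color_all k A g.
set s1 := run _ s; set s2 := run _ s1; set s3 := run _ s2; set s4 := run _ s3.
have [keep_n keep_accept keep_points keep_adj] := keeps_guess_colors k g.
have hs1 : stores A col s1.
  by split;
    [apply: stores_graph_frame (frame_run _ _) hs | apply: coloring_guess_colors].
have [[closed2 consistent2] complete2] := solve_ends_spec k A_sym hs1.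
have hs2 : stores A col s2.
  by apply: stores_run hs1;
    rewrite /= ?keeps_reg_solve_components ?keeps_arr_solve_components.
have hs3 : stores A col s3 by apply: stores_run.
have accept3 : reg s3 r_accept = 0.
  by rewrite reg_run // reg_run /= ?keeps_reg_solve_components // reg_run.
have verified := verify_spec k hs2; rewrite -/s3 in verified.
have hs4 : stores A col s4 by apply: stores_run.
have [[_ s4_points _] _] := hs4.
rewrite -/s4; split=> //; first by case: hs4.
- rewrite /s4 run_if; case: ifP => [/verified[all_solved col_lt clique]|_];
    last by rewrite run_skip accept3.
  have [_ edges colors tail_points head_points] := write_root_graph_spec hs3.
  move=> _; have cert : certificate A k col (solution s3).
    split=> // v; have := consistent2 v; rewrite all_solved => /(_ (in_setT v)).
    by apply: eq_consistent_at => [u|w _ u]; apply: entry_frame (frame_run _ _).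
  apply: (solution_of_certificate cert) => //.
  by have [[_ ? _] _] : stores A col (run write_root_graph s3) by apply: stores_run.
move=> x cert; rewrite /s4 run_if (_ : test s3 $r_flag = true).
  by have [-> _ _ _ _] := write_root_graph_spec hs3.
apply/verified; split; [|exact: color_lt cert|exact: color_clique cert].
by apply: complete2; [exact: color_lt cert | exists x; exact: ends_consistent cert].
Qed.

Lemma try_guesses_spec gs s : stores_graph A s ->
  (reg s r_accept != 0 -> solution_found s) ->
  let s' := run (seqs [seq try_guess k g | g <- gs]) s in
  [/\ reg s' r_accept != 0 -> solution_found s',
      reg s r_accept != 0 -> reg s' r_accept != 0 &
      forall x g, g \in gs -> certificate A k (color_all k A g) x ->
        reg s' r_accept != 0].
Proof.
elim: gs s => [|g gs IH] s hs found; first by [].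
rewrite map_cons run_seqs_cons.
have [hs1 found1 stays1 cert1] := try_guess_spec g hs found.
have [found2 stays2 cert2] := IH _ hs1 found1; split=> // [/stays1|x g'];
  first exact: stays2.
by move=> /predU1P[->|g'_in] cert; [apply/stays2/cert1/cert | apply: cert2 cert].
Qed.

Lemma entry_read_graph (ps : seq ('I_n * 'I_n)) s :
  reg s r_vertices = n -> reg s r_edges = size ps ->
  (forall i, arr s a_tail i = nth 0 [seq val p.1 | p <- ps] i) ->
  (forall i, arr s a_head i = nth 0 [seq val p.2 | p <- ps] i) ->
  (forall i, arr s a_adj i = 0) ->
  forall u v, entry (run read_graph s) a_adj u v = ((u, v) \in ps) || ((v, u) \in ps).
Proof.
move=> sn s_edges tailE headE adj0 u v.
pose I m s' := forall u v,
  entry s' a_adj u v = ((u, v) \in take m ps) || ((v, u) \in take m ps).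
suff inv : I (size ps) (run read_graph s) by rewrite inv take_size.
rewrite -s_edges; apply: run_for => // [u' v'|m s'];
  first by rewrite take0 /entry adj0.
rewrite s_edges => mps [fr_reg fr_arr] s'm inv {}u {}v; have {inv} := inv u v.
case: ps mps tailE headE {I s_edges} => // p0 ps;
  set qs := p0 :: ps => mps tailE headE.
rewrite (take_nth p0) // !mem_rcons !inE orbACA /entry => <-; rewrite !runE /= s'm.
rewrite (fr_arr a_tail) // (fr_arr a_head) // fr_reg // sn tailE headE.
rewrite !(nth_map p0) // !eq_cell; case: (nth p0 qs m) => a b; rewrite -!pair_eqE /=.
by case: (u == a); case: (v == b); case: (u == b); case: (v == a).
Qed.

End Recognition.

Lemma nth_map_lt T (f : T -> nat) (s : seq T) i B :
  0 < B -> (forall x, f x < B) -> nth 0 [seq f x | x <- s] i < B.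
Proof.
move=> B_gt0 f_lt; have [i_s|s_i] := ltnP i (size s);
  last by rewrite nth_default ?size_map.
by case: s i_s => // x0 s i_s; rewrite (nth_map x0).
Qed.

Section Input.
Variables (k : nat) (G : sgraph) (es : seq (G * G)).
Hypothesis es_edges : edge_list es.

Local Notation n := #|G|.

Definition start_state : state := set_reg (input_state es) r_points (n + n).

Definition rank_pairs : seq ('I_n * 'I_n) :=
  [seq (enum_rank p.1, enum_rank p.2) | p <- es].

Lemma mem_rank_pairs u v :
  ((u, v) \in rank_pairs) || ((v, u) \in rank_pairs) = ord_adj u v.
Proof.
have rank_inj : injective (fun p : G * G => (enum_rank p.1, enum_rank p.2)).
  by move=> [a b] [c d] [/enum_rank_inj-> /enum_rank_inj->].
rewrite -(enum_valK u) -(enum_valK v) /ord_adj !enum_rankK.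
move: (enum_val u) (enum_val v) => x y {u v}.
rewrite (mem_map rank_inj _ (x, y)) (mem_map rank_inj _ (y, x))
  -mem_edge_set -[RHS]mem_enum.
rewrite -(perm_mem es_edges); apply/orP/mapP => [[xy|yx]|[[a b] ab /=]].
- by exists (x, y).
- by exists (y, x); rewrite // setUC.
- by case/eq_set2=> -[-> ->]; [left | right].
Qed.

Lemma stores_graph_start : stores_graph (@ord_adj G) (run read_graph start_state).
Proof.
split=> [||u v]; rewrite ?reg_run // -mem_rank_pairs; apply: entry_read_graph => //=.
- by rewrite size_map.
- by move=> i; rewrite -map_comp.
- by move=> i; rewrite -map_comp.
- by move=> i; rewrite nth_nil.
Qed.

Lemma recognize_spec : 0 < k -> let s := run (recognize k) start_state in
  (reg s r_accept != 0 -> solution_found k (@ord_adj_sym G) (@ord_adj_irr G) s) /\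
  (proper_color_line_graph k G -> reg s r_accept != 0).
Proof.
move=> k_gt0; rewrite /recognize run_seq.
have not_accepted : reg (run read_graph start_state) r_accept = 0 by rewrite reg_run.
have [|found _ complete] := @try_guesses_spec n k _ (@ord_adj_sym G) (@ord_adj_irr G)
  (color_strings k) _ stores_graph_start.
  by rewrite not_accepted.
split=> // -[H [phi [proper iso]]].
have [col [x cert]] : exists col x, certificate (@ord_adj G) k col x.
  apply: (@certificate_of_coloring k (ord_graph G)); exists H, phi; split=> //.
  exact: graph_iso_trans (graph_iso_sym (ord_graph_iso G)) iso.
have [g g_col] := guess_of_certificate k_gt0 cert.
apply: (complete x [seq val c | c <- g]); first by apply: codom_f.
by rewrite g_col.
Qed.

Lemma size_edge_list : size es = #|edge_set G|.
Proof. by move/perm_size: es_edges; rewrite size_map -cardE. Qed.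

Lemma size_edge_list_le : size es <= n ^ 2.
Proof.
rewrite size_edge_list.
apply: (@leq_trans #|[set [set p.1; p.2] | p in {: G * G}]|).
  apply/subset_leq_card/subsetP => e /imset2P[x y _ _ ->].
  by apply/imsetP; exists (x, y).
by apply: leq_trans (leq_imset_card _ _) _; rewrite card_prod mulnn.
Qed.

Lemma start_state_below : memory_below ((n + 2) ^ 2) start_state.
Proof.
set B := (n + 2) ^ 2; have B_gt0 : 0 < B by rewrite expn_gt0 addn2.
have nn_lt : n + n < B by rewrite /B expnS; lia.
have n_lt : n < B by apply: leq_ltn_trans nn_lt; apply: leq_addr.
have es_lt : size es < B.
  by apply: leq_ltn_trans size_edge_list_le _; rewrite ltn_exp2r // addn2 ltnW.
have rank_lt (x : G) : nat_of_ord (enum_rank x) < B := ltn_trans (ltn_ord _) n_lt.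
apply: memory_below_set_reg => //.
by split=> [[|[|r]]|[|[|a]] i] //=; rewrite ?nth_nil //; apply: nth_map_lt.
Qed.

Lemma start_state_bounds : bounds_hold (maxn 1 n) start_state.
Proof.
have n_le : n <= maxn 1 n by apply: leq_maxr.
move=> [|[|[|[|b]]]] //; rewrite /bound_degree /= ?expn1 => _.
- exact: leq_trans n_le (leq_pmull _ _).
- apply: leq_trans size_edge_list_le _.
  by apply: (@leq_trans (maxn 1 n ^ 2)); rewrite ?leq_exp2r ?leq_pmull.
- by rewrite mul2n -addnn leq_add.
Qed.

End Input.

Definition recognition_program (k : nat) : cmd :=
  Seq (Assign r_points ($r_vertices + $r_vertices)%E) (compile (recognize k)).

Lemma recognition_program_halts k : exists C c,
  forall (G : sgraph) (es : seq (G * G)), edge_list es ->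
    halts_within ((#|G| + 2) ^ c) (recognition_program k) (input_state es)
      (run (recognize k) (start_state es)) (C * maxn 1 #|G| ^ 5).
Proof.
have [c halts] := compile_polynomial (recognize_well_formed k).
exists (4 + coefficient (recognize k)), c => G es es_edges; set n := #|G|.
have [||le_W halts_rec] := halts (n + 2) (maxn 1 n) (start_state es) _ _
  (start_state_below es_edges) (start_state_bounds es_edges).
- by rewrite addn2.
- by rewrite leq_maxl.
have N_gt0 : 0 < maxn 1 n by rewrite leq_maxl.
have start : halts_within ((n + 2) ^ c)
    (Assign r_points ($r_vertices + $r_vertices)%E)
    (input_state es) (start_state es) 4.
  exists 4 => //; apply: ExecAssign; rewrite /= -/n.
  by rewrite !(leq_trans _ le_W) // expnS; lia.
apply: halts_weaken (halts_seq start halts_rec); rewrite mulnDl leq_add //.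
  by rewrite leq_pmulr // expn_gt0 N_gt0.
by rewrite leq_mul2l leq_pexp2l ?degree_recognize ?orbT.
Qed.

Theorem theorem8 (k : nat) (hk : 1 <= k) :
  exists (p : cmd) (C c : nat),
    forall (G : sgraph) (es : seq (G * G)), edge_list es ->
      let n := #|G| in
      let m := #|edge_set G| in
      exists (s : state) (t : nat),
        [/\ exec ((n + 2) ^ c) p (input_state es) s t,
            0 < n -> t <= C * (n ^ (k + 4) * (n + m)),
            accepts s <-> proper_color_line_graph k G
          & proper_color_line_graph k G ->
            exists (H : sgraph) (phi : edge H -> 'I_k),
              [/\ proper_coloring phi, graph_iso G (CL phi)
                & outputs s phi]].
Proof.
have [C [c halts]] := recognition_program_halts k.
exists (recognition_program k), C, c => G es es_edges n m.
have [t run_t le_t] := halts G es es_edges.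
have [sound complete] := recognize_spec es_edges hk.
set s := run (recognize k) (start_state es) in run_t sound complete.
have solved : accepts s -> exists (H : sgraph) (phi : edge H -> 'I_k),
    [/\ proper_coloring phi, graph_iso G (CL phi) & outputs s phi].
  move=> /sound[H [phi [proper iso out]]]; exists H, phi; split=> //.
  exact: graph_iso_trans (ord_graph_iso G) iso.
exists s, t; split=> //.
- move=> n_gt0; apply: leq_trans le_t _; rewrite (maxn_idPr n_gt0) leq_mul2l.
  have le_pow : n ^ 5 <= n ^ (k + 4) by rewrite leq_pexp2l // (leq_add2r 4 1).
  by rewrite (leq_trans le_pow) ?orbT // leq_pmulr // addn_gt0 n_gt0.
- by split=> [/solved[H [phi [proper iso _]]]|/complete//]; exists H, phi.
- by move=> /complete/solved.
Qed.
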